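(* Assume $\sigma_1\ge\sigma_2$. Let $\mathcal M_{\downarrow}$, $\mathcal T$, $\widetilde{\mathcal T}$, $\mathcal B_i$, $\mathcal H_i^{+}$, $\mathcal H_i^{-}$, $\mathcal C_i$ ($i\in\{1,2\}$) be the sets defined in the context. (i) If $r\in\big(0,\frac{L}{2\sigma_1}\big]$, then $\mathcal M_{\downarrow}$ is open and $$\partial\mathcal M_{\downarrow}=\mathcal T\sqcup\{\mathbf x_1^*,\mathbf x_2^*\}\quad\text{and}\quad(\mathcal M_{\downarrow})^{\circ}=\widetilde{\mathcal T}.$$ (ii) If $r\in\big(\frac{L}{2\sigma_1},\frac{L}{2\sigma_2}\big]$, then $(\mathcal M_{\downarrow}\cup\mathcal C_1)\cap\mathcal H_1^+$ is closed while $\mathcal M_{\downarrow}\cap(\mathcal H_1^+)^c$ is open, and $$\partial\mathcal M_{\downarrow}=\big[\partial\mathcal B_1\cap(\mathcal H_1^-)^c\big]\sqcup\mathcal T\sqcup\{\mathbf x_1^*\}\quad\text{and}\quad(\mathcal M_{\downarrow})^{\circ}=\big[\mathcal B_1\cap(\mathcal H_1^-)^c\big]\sqcup\big[\widetilde{\mathcal T}\cap\mathcal H_1^-\big].$$ (iii) If $r\in\Big(\frac{L}{2\sigma_2},\frac L2\big(\frac1{\sigma_1}+\frac1{\sigma_2}\big)\Big)$, then $(\mathcal M_{\downarrow}\cup\mathcal C_1)\cap\mathcal H_1^+$ and $(\mathcal M_{\downarrow}\cup\mathcal C_2)\cap\mathcal H_2^-$ are closed while $\mathcal M_{\downarrow}\cap(\mathcal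 H_1^+\cup\mathcal H_2^-)^c$ is open, and $$\partial\mathcal M_{\downarrow}=\big[\partial\mathcal B_1\cap(\mathcal H_1^-)^c\big]\sqcup\big[\partial\mathcal B_2\cap(\mathcal H_2^+)^c\big]\sqcup\mathcal T\quad\text{and}$$ $$(\mathcal M_{\downarrow})^{\circ}=\big[\mathcal B_1\cap(\mathcal H_1^-)^c\big]\sqcup\big[\mathcal B_2\cap(\mathcal H_2^+)^c\big]\sqcup\big[\widetilde{\mathcal T}\cap(\mathcal H_1^-\cap\mathcal H_2^+)\big].$$ (iv) If $r=\frac L2\big(\frac1{\sigma_1}+\frac1{\sigma_2}\big)$, then $\mathcal M_{\downarrow}=\Big\{\Big(\frac L2\big(\frac1{\sigma_1}-\frac1{\sigma_2}\big),\mathbf 0\Big)\Big\}$. (v) If $r\in\Big(\frac L2\big(\frac1{\sigma_1}+\frac1{\sigma_2}\big),\infty\Big)$, then $\mathcal M_{\downarrow}=\emptyset$.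
   Context: Fix a positive integer $n$, real numbers $r,\sigma_1,\sigma_2,L>0$, and $\mathbf x_1^*=(-r,0,\dots,0)$, $\mathbf x_2^*=(r,0,\dots,0)\in\mathbb R^n$. Points are written $\mathbf x=(x_1,\tilde{\mathbf x})$ with $x_1\in\mathbb R$, $\tilde{\mathbf x}\in\mathbb R^{n-1}$; $\|\cdot\|$ is the Euclidean norm. $\mathcal E^c$, $\mathcal E^\circ$, $\overline{\mathcal E}$, $\partial\mathcal E=\overline{\mathcal E}\setminus\mathcal E^\circ$ are complement, interior, closure and boundary in $\mathbb R^n$; $\sqcup$ denotes a union of pairwise disjoint sets. $\angle(\mathbf u,\mathbf v)=\arccos\frac{\langle\mathbf u,\mathbf v\rangle}{\|\mathbf u\|\|\mathbf v\|}\in[0,\pi]$ for nonzero $\mathbf u,\mathbf v$. For $i\in\{1,2\}$: $\mathcal B_i=\{\mathbf x\in\mathbb R^n:\|\mathbf x-\mathbf x_i^*\|<L/\sigma_i\}$; $\tilde\phi_i(\mathbf x)=\arccos\big(\frac{\sigma_i}{L}\|\mathbf x-\mathbf x_i^*\|\big)$ for $\mathbf x\in\overline{\mathcal B}_i$; $\alpha_i(\mathbf x)=\angle(\mathbf x-\mathbf x_i^*,\mathbf x_2^*-\mathbf x_1^* )$ for $\mathbf x\ne\mathbf x_i^*$. For $\mathbf x\notin\{\mathbf x_1^*,\mathbf x_2^*\}$, $\psi(\mathbf x)=\pi-(\alpha_2(\mathbf x)-\alpha_1(\mathbf x))$. $\widetilde{\mathcal T}=\{\mathbf x\in\mathbb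 R^n:\tilde\phi_1(\mathbf x)+\tilde\phi_2(\mathbf x)>\psi(\mathbf x)\}$, where $\mathbf x$ is implicitly required to lie in the common domain $(\overline{\mathcal B}_1\cap\overline{\mathcal B}_2)\setminus\{\mathbf x_1^*,\mathbf x_2^*\}$ of $\tilde\phi_1,\tilde\phi_2,\psi$. Let $\mathcal X=\{\mathbf x\in\mathbb R^n:\|\mathbf x-\mathbf x_i^*\|=L/\sigma_i\text{ for }i=1,2\}$ if $\|\mathbf x_2^*-\mathbf x_1^*\|=L\big(\frac1{\sigma_1}+\frac1{\sigma_2}\big)$, and $\mathcal X=\emptyset$ otherwise. Inner approximation: $\mathcal M_{\downarrow}=\{\mathbf x\in\mathbb R^n:\tilde\phi_1(\mathbf x)+\tilde\phi_2(\mathbf x)>\psi(\mathbf x)\}\cup\mathcal X$ (same domain convention). With $d_i(\mathbf x)=\|\mathbf x-\mathbf x_i^*\|$, $$\mathcal T=\Big\{\mathbf x\in\mathbb R^n:\tfrac{\|\mathbf x\|^2-r^2}{d_1^2(\mathbf x)d_2^2(\mathbf x)}+\tfrac{\sigma_1\sigma_2}{L^2}=\sqrt{\tfrac1{d_1^2(\mathbf x)}-\tfrac{\sigma_1^2}{L^2}}\cdot\sqrt{\tfrac1{d_2^2(\mathbf x)}-\tfrac{\sigma_2^2}{L^2}}\Big\},$$ where it is implicitly required that all expressions are defined (i.e. $\mathbf x\notin\{\mathbf x_1^*,\mathbf x_2^*\}$ and both radicands are nonnegative). Let $\gamma_i=L^2/\sigma_i^2$, $\beta=\sigma_2/\sigma_1$,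 $\lambda_1=\big(\frac{1+\beta}{1+2\beta}\big)\frac{\gamma_1}{2r}-\frac{r}{1+2\beta}$, $\lambda_2=-\big(\frac{1+\beta}{2+\beta}\big)\frac{\gamma_2}{2r}+\frac{\beta r}{2+\beta}$, $$\nu_1=\tfrac{r}{2(1+2\beta)}\sqrt{-\big(\tfrac{\gamma_1}{r^2}-4\big)\big((1+\beta)^2\tfrac{\gamma_1}{r^2}-4\beta^2\big)},\qquad \nu_2=\tfrac{r}{2(2+\beta)}\sqrt{-\big(\tfrac{\gamma_2}{r^2}-4\big)\big((1+\beta)^2\tfrac{\gamma_2}{r^2}-4\big)}.$$ For $i\in\{1,2\}$: $\mathcal H_i^+=\{\mathbf x\in\mathbb R^n:x_1\ge\lambda_i\}$, $\mathcal H_i^-=\{\mathbf x\in\mathbb R^n:x_1\le\lambda_i\}$, $\mathcal C_i=\{\mathbf x\in\mathbb R^n:x_1=\lambda_i,\ \|\tilde{\mathbf x}\|=\nu_i\}$ (used only where $\nu_i$ is real). *)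

(* Defs.v *)
From mathcomp Require Import all_boot all_order all_algebra.
From mathcomp Require Import all_classical all_reals all_analysis.
Import Order.TTheory GRing.Theory Num.Theory.
Import numFieldNormedType.Exports.

Set Implicit Arguments.
Unset Strict Implicit.
Unset Printing Implicit Defensive.

Local Open Scope classical_set_scope.
Local Open Scope ring_scope.

(* The library norm `|x| on row vectors is the sup norm, hence the explicit
   Euclidean norm.  Open, closed, closure and interior are those of the library
   topology on 'rV[R]_m, which is the product (i.e. the Euclidean) topology. *)
Definition dotp (R : realType) (m : nat) (u v : 'rV[R]_m) : R :=
  \sum_(j < m) u 0 j * v 0 j.

Definition enorm (R : realType) (m : nat) (u : 'rV[R]_m) : R :=
  Num.sqrt (dotp u u).

(* Meaningful for nonzero u and v only. *)
Definition angle (R : realType) (m : nat) (u v : 'rV[R]_m) : R :=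
  acos (dotp u v / (enorm u * enorm v)).

Definition boundary (T : topologicalType) (E : set T) : set T :=
  closure E `\` E°.

(* S is the union of the pairwise disjoint sets listed in As. *)
Definition is_sqcup (T : Type) (S : set T) (As : seq (set T)) : Prop :=
  S = \big[setU/set0]_(A <- As) A /\ trivIset [set: nat] (nth set0 As).

Section Setting.
Variables (R : realType) (n : nat) (r sigma1 sigma2 L : R).

(* The ambient space of dimension n.+1 >= 1; x = (x_1, x~) with x_1 = x 0 0 and
   x~ = col' ord0 x, of dimension n. *)
Local Notation E := 'rV[R]_n.+1.

Definition axis_pt (a : R) : E := \row_j (if j == 0 then a else 0).

Definition x1s : E := axis_pt (- r).
Definition x2s : E := axis_pt r.

Definition B1 : set E := [set x | enorm (x - x1s) < L / sigma1].
Definition B2 : set E := [set x | enorm (x - x2s) < L / sigma2].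

(* acos is a total function: phi1, phi2, alpha1, alpha2 and psi are only used
   on angle_dom below. *)
Definition phi1 (x : E) : R := acos (sigma1 / L * enorm (x - x1s)).
Definition phi2 (x : E) : R := acos (sigma2 / L * enorm (x - x2s)).

Definition alpha1 (x : E) : R := angle (x - x1s) (x2s - x1s).
Definition alpha2 (x : E) : R := angle (x - x2s) (x2s - x1s).

Definition psi (x : E) : R := pi - (alpha2 x - alpha1 x).

Definition angle_dom : set E :=
  (closure B1 `&` closure B2) `\` [set x1s; x2s].

Definition Ttilde : set E :=
  [set x | angle_dom x /\ phi1 x + phi2 x > psi x].

Definition Xset : set E :=
  [set x | [/\ enorm (x2s - x1s) = L * (1 / sigma1 + 1 / sigma2),
               enorm (x - x1s) = L / sigma1
             & enorm (x - x2s) = L / sigma2]].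

Definition Mdown : set E := Ttilde `|` Xset.

Definition d1 (x : E) : R := enorm (x - x1s).
Definition d2 (x : E) : R := enorm (x - x2s).

Definition Tset : set E :=
  [set x | [/\ x <> x1s, x <> x2s,
      0 <= 1 / d1 x ^+ 2 - sigma1 ^+ 2 / L ^+ 2,
      0 <= 1 / d2 x ^+ 2 - sigma2 ^+ 2 / L ^+ 2
    & (enorm x ^+ 2 - r ^+ 2) / (d1 x ^+ 2 * d2 x ^+ 2)
        + sigma1 * sigma2 / L ^+ 2
      = Num.sqrt (1 / d1 x ^+ 2 - sigma1 ^+ 2 / L ^+ 2)
        * Num.sqrt (1 / d2 x ^+ 2 - sigma2 ^+ 2 / L ^+ 2)]].

Definition gamma1 : R := L ^+ 2 / sigma1 ^+ 2.
Definition gamma2 : R := L ^+ 2 / sigma2 ^+ 2.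
Definition beta : R := sigma2 / sigma1.

Definition lambda1 : R :=
  (1 + beta) / (1 + 2 * beta) * (gamma1 / (2 * r)) - r / (1 + 2 * beta).
Definition lambda2 : R :=
  - ((1 + beta) / (2 + beta)) * (gamma2 / (2 * r)) + beta * r / (2 + beta).

Definition nu1_arg : R :=
  - (gamma1 / r ^+ 2 - 4)
  * ((1 + beta) ^+ 2 * (gamma1 / r ^+ 2) - 4 * beta ^+ 2).
Definition nu2_arg : R :=
  - (gamma2 / r ^+ 2 - 4) * ((1 + beta) ^+ 2 * (gamma2 / r ^+ 2) - 4).

Definition nu1 : R := r / (2 * (1 + 2 * beta)) * Num.sqrt nu1_arg.
Definition nu2 : R := r / (2 * (2 + beta)) * Num.sqrt nu2_arg.

Definition H1p : set E := [set x : E | x 0 0 >= lambda1].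
Definition H1m : set E := [set x : E | x 0 0 <= lambda1].
Definition H2p : set E := [set x : E | x 0 0 >= lambda2].
Definition H2m : set E := [set x : E | x 0 0 <= lambda2].

(* Num.sqrt is 0 on negative numbers, so C1 (resp. C2) has its intended meaning
   only when 0 <= nu1_arg (resp. 0 <= nu2_arg).  For sigma1 >= sigma2 > 0 and
   r < L / 2 * (1 / sigma1 + 1 / sigma2), this holds for nu1_arg as soon as
   r > L / (2 * sigma1), and for nu2_arg as soon as r > L / (2 * sigma2). *)
Definition C1 : set E :=
  [set x : E | x 0 0 = lambda1 /\ enorm (col' ord0 x) = nu1].
Definition C2 : set E :=
  [set x : E | x 0 0 = lambda2 /\ enorm (col' ord0 x) = nu2].

End Setting.

(* Main.v *)
Require Import Defs.
From mathcomp Require Import all_boot all_order all_algebra.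
From mathcomp Require Import all_classical all_reals all_analysis.
From mathcomp Require Import ring lra.
Import Order.TTheory GRing.Theory Num.Theory.
Import numFieldNormedType.Exports.

(** Put s = sigma1 / L and t = sigma2 / L, and let a and b be the squared
    distances from x to the foci x1* and x2*.  Since psi is pi minus the angle
    under which x sees the two foci, cos psi is
    - <x - x1*, x - x2*> / (d1 d2); and since phi1 + phi2 and psi both lie in
    [0, pi], where the cosine decreases, phi1 + phi2 > psi means that
    [[
      gap = <x - x1*, x - x2*> + s t a b
              - sqrt (a (1 - s^2 a)) sqrt (b (1 - t^2 b))
    ]]
    is negative ([angle_sum_gt_gap]).  The gap is continuous on the whole space
    and vanishes at the foci, so in the lens formed by the two closed balls T~
    is the part where the gap is negative, and T is the zero set of the gap
    without the foci ([TtildeE], [TsetE]).  Unless the balls touch, M is T~.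

    As long as the two balls overlap, 2 r < L/sigma1 + L/sigma2, three facts
    determine the topology of M.
    - On the sphere s^2 a = 1 the product of roots vanishes and the gap becomes
      an affine function of x_1, negative exactly beyond the hyperplane
      x_1 = lambda1 ([sphere_gap_edge], [edge1_lt0]).  Moving into the ball at
      constant x_1 lowers the gap further, and the part of the closed ball
      beyond the hyperplane stays strictly inside the other ball
      ([beyond_edge_gap], [beyond_edge_inside]), so it lies in M up to the
      circle C_1.  The situation at the second ball is symmetric.
    - A point of M on one of the spheres is not interior, since the points
      just outside the sphere are not in M.  Hence the interior of M is the
      part of M in both open balls ([region_interior]).
    - Every zero of the gap in the lens is a limit of points of M
      ([gapf0_closure]).  Off the axis through the foci this holds because
      decreasing one of a, b makes the gap negative ([gap0_descent]); a and b
      serve as local coordinates there, and decreasing them never leaves the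
      lens.  Near a focus, the points of the segment between the foci do it.

    Therefore the boundary of M consists of two spherical caps, of T, and of
    the foci that belong to the lens ([boundary_Mdown]).  The position of r with
    respect to L/(2 sigma1) and L/(2 sigma2) decides which foci are in the lens,
    and a cap is empty as soon as the opposite focus lies in its ball
    ([cball_before_edge1]).  When the balls touch or are disjoint, the lens is
    a point or empty ([lens_tangent]). *)

Set Implicit Arguments.
Unset Strict Implicit.
Unset Printing Implicit Defensive.

Local Open Scope classical_set_scope.
Local Open Scope ring_scope.

(** * The gap as a function of the squared distances to the foci *)

Section RadialCoordinates.
Variable R : rcfType.
Implicit Types s t r a b d p w u e : R.

(** The inner product <x - x1*, x - x2*>: by the parallelogram law, the squared
    distances add up to it twice plus the squared focal distance (2 r)^2. *)
Definition focal_dot r a b := (a + b) / 2 - 2 * r ^+ 2.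
Definition excess s t r a b := focal_dot r a b + s * t * (a * b).

(** With cos phi = s d and a = d^2, this is d^2 sin^2 phi. *)
Definition sinsq s a := a * (1 - s ^+ 2 * a).

(** This is d1 d2 (cos (phi1 + phi2) - cos psi). Multiplying by the distances
    keeps it continuous at the foci, and with the total square root it is
    defined outside the lens too. *)
Definition gap s t r a b :=
  excess s t r a b - Num.sqrt (sinsq s a) * Num.sqrt (sinsq t b).

(** The affine function of d = a - b = 4 r x_1 that s^3 times the excess becomes
    on the sphere s^2 a = 1; its zero is the hyperplane x_1 = lambda1, and
    exchanging the foci (d into -d, s and t swapped) gives x_1 = lambda2. *)
Definition edge s t r d :=
  s + t - 2 * r ^+ 2 * s ^+ 3 - s ^+ 2 * (s / 2 + t) * d.

Lemma excessC s t r a b : excess s t r a b = excess t s r b a.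
Proof. by rewrite /excess /focal_dot; ring. Qed.

Lemma gapC s t r a b : gap s t r a b = gap t s r b a.
Proof. by rewrite /gap excessC [Num.sqrt (sinsq s a) * _]mulrC. Qed.

Lemma gap_lt0_excess s t r a b : excess s t r a b < 0 -> gap s t r a b < 0.
Proof.
move=> h; rewrite /gap subr_lt0; apply: (lt_le_trans h).
by rewrite mulr_ge0 ?sqrtr_ge0.
Qed.

(** Together with [gap_eq0_sqr], this trades the square roots of the gap for the
    polynomial sinsq s a * sinsq t b - excess ^ 2. *)
Lemma gap_lt0_sqr s t r a b : 0 <= sinsq s a ->
  excess s t r a b ^+ 2 < sinsq s a * sinsq t b -> gap s t r a b < 0.
Proof.
move=> ca h; rewrite /gap subr_lt0 -sqrtrM //.
apply: (le_lt_trans (ler_norm _)); rewrite -sqrtr_sqr ltr_sqrt //.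
exact: le_lt_trans (sqr_ge0 _) h.
Qed.

Lemma gap_eq0_sqr s t r a b : 0 <= sinsq s a -> 0 <= sinsq t b ->
  gap s t r a b = 0 ->
  0 <= excess s t r a b /\ excess s t r a b ^+ 2 = sinsq s a * sinsq t b.
Proof.
move=> ca cb /eqP; rewrite /gap subr_eq0 => /eqP ->.
by rewrite mulr_ge0 ?sqrtr_ge0 // exprMn !sqr_sqrtr.
Qed.

Lemma gap_sphere s t r a b : s ^+ 2 * a = 1 ->
  gap s t r a b = excess s t r a b.
Proof. by move=> h; rewrite /gap /sinsq h subrr mulr0 sqrtr0 mul0r subr0. Qed.

Lemma excess_edge s t r a b : s ^+ 3 * excess s t r a b =
  edge s t r (a - b) - (1 - s ^+ 2 * a) * (s + t + s ^+ 2 * t * b).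
Proof. by rewrite /excess /edge /focal_dot; field. Qed.

Lemma sphere_gap_edge s t r a b : 0 < s -> s ^+ 2 * a = 1 ->
  (gap s t r a b < 0) = (edge s t r (a - b) < 0).
Proof.
move=> s0 ha; rewrite gap_sphere //.
rewrite -(pmulr_rlt0 (excess s t r a b) (exprn_gt0 3 s0)).
by rewrite excess_edge ha subrr mul0r subr0.
Qed.

Lemma sphere_gap0_edge s t r a b : 0 < s -> s ^+ 2 * a = 1 ->
  gap s t r a b = 0 -> edge s t r (a - b) = 0.
Proof.
move=> s0 ha; rewrite gap_sphere // => h.
by have := excess_edge s t r a b; rewrite ha h subrr mul0r subr0 mulr0.
Qed.

(** At fixed a - b, that is at fixed x_1, the excess increases with a: the
    correction term in [excess_edge] has a constant sign in the ball.  So a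
    point beyond the hyperplane inherits a negative excess from the sphere. *)
Lemma beyond_edge_gap s t r a b : 0 < s -> 0 < t -> 0 <= b ->
  s ^+ 2 * a <= 1 -> edge s t r (a - b) <= 0 ->
  s ^+ 2 * a < 1 \/ edge s t r (a - b) < 0 -> gap s t r a b < 0.
Proof.
move=> s0 t0 b0 ha he strict; apply: gap_lt0_excess.
rewrite -(pmulr_rlt0 _ (exprn_gt0 3 s0)) excess_edge.
have k0 : 0 < s + t + s ^+ 2 * t * b.
  by rewrite ltr_pwDl ?addr_gt0 // mulr_ge0 // mulr_ge0 ?sqr_ge0 // ltW.
case: strict => hs.
  have : 0 < (1 - s ^+ 2 * a) * (s + t + s ^+ 2 * t * b).
    by rewrite mulr_gt0 ?subr_gt0.
  lra.
have : 0 <= (1 - s ^+ 2 * a) * (s + t + s ^+ 2 * t * b).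
  by rewrite mulr_ge0 ?subr_ge0 // ltW.
lra.
Qed.

(** The overlap condition 2 r < 1/s + 1/t is kept in the form cleared of
    denominators; its square is what the polynomial inequalities below use. *)
Lemma overlap_sqr s t r : 0 < s -> 0 < t -> 0 < r ->
  2 * r * s * t < s + t -> 4 * r ^+ 2 * s ^+ 2 * t ^+ 2 < (s + t) ^+ 2.
Proof.
move=> s0 t0 r0 h.
have -> : 4 * r ^+ 2 * s ^+ 2 * t ^+ 2 = (2 * r * s * t) ^+ 2 by ring.
by rewrite ltr_pXn2r // nnegrE; [rewrite !mulr_ge0 // ltW | rewrite addr_ge0 // ltW].
Qed.

(** Where the two spheres meet, the edge form takes the sign of
    (s + t)^2 - (2 r s t)^2, hence is positive: the hyperplane cuts the ball
    beyond that intersection, in the interior of the other ball. *)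
Lemma beyond_edge_inside s t r a b : 0 < s -> 0 < t -> 0 < r ->
  2 * r * s * t < s + t -> s ^+ 2 * a <= 1 -> edge s t r (a - b) <= 0 ->
  t ^+ 2 * b < 1.
Proof.
move=> s0 t0 r0 /(overlap_sqr s0 t0 r0) hr ha; rewrite /edge => he.
have k0 : 0 < s ^+ 2 * (s / 2 + t).
  by rewrite mulr_gt0 ?exprn_gt0 // addr_gt0 // divr_gt0.
rewrite -(ltr_pM2l k0) mulr1.
have h1 : t ^+ 2 * (s ^+ 2 * (s / 2 + t) * (a - b)) >=
   t ^+ 2 * (s + t - 2 * r ^+ 2 * s ^+ 3).
  by apply: ler_wpM2l; [exact: sqr_ge0 | lra].
have h2 : t ^+ 2 * (s / 2 + t) * (s ^+ 2 * a) <= t ^+ 2 * (s / 2 + t) * 1.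
  apply: ler_wpM2l => //; rewrite mulr_ge0 ?sqr_ge0 // addr_ge0 ?divr_ge0 //; lra.
have h3 : s / 2 * (4 * r ^+ 2 * s ^+ 2 * t ^+ 2) < s / 2 * (s + t) ^+ 2.
  by rewrite ltr_pM2l // divr_gt0.
lra.
Qed.

(** The radical hyperplane of the two spheres separates the two hyperplanes, for
    the reason given at [beyond_edge_inside]; thus lambda2 < lambda1. *)
Lemma edges_disjoint s t r d : 0 < s -> 0 < t -> 0 < r ->
  2 * r * s * t < s + t -> edge s t r d <= 0 -> 0 < edge t s r (- d).
Proof.
move=> s0 t0 r0 /(overlap_sqr s0 t0 r0) hr; rewrite /edge => he.
have k0 : 0 < s ^+ 2 * (s / 2 + t).
  by rewrite mulr_gt0 ?exprn_gt0 // addr_gt0 // divr_gt0.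
rewrite -(pmulr_rgt0 _ k0).
have l0 : 0 <= t ^+ 2 * (t / 2 + s).
  by rewrite mulr_ge0 ?sqr_ge0 // addr_ge0 ?divr_ge0 // ltW.
have h1 : t ^+ 2 * (t / 2 + s) * (s ^+ 2 * (s / 2 + t) * d) >=
   t ^+ 2 * (t / 2 + s) * (s + t - 2 * r ^+ 2 * s ^+ 3).
  by apply: ler_wpM2l => //; lra.
(* With this weight the terms free of r balance exactly. *)
have h3 : (s ^+ 2 + s * t + t ^+ 2) / 2 * (4 * r ^+ 2 * s ^+ 2 * t ^+ 2)
   < (s ^+ 2 + s * t + t ^+ 2) / 2 * (s + t) ^+ 2.
  rewrite ltr_pM2l // divr_gt0 // addr_gt0 ?exprn_gt0 // addr_gt0 ?exprn_gt0 //.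
  exact: mulr_gt0.
lra.
Qed.

(** The largest first coordinate in the ball is 1/s - r, where the edge form
    equals (1 - 2 r s) (s + t - 2 r s t); this is nonnegative when the ball
    contains the other focus. *)
Lemma edge_ge0_far_focus s t r p w : 0 < s -> 0 < t -> 0 < r -> 2 * r * s <= 1 ->
  0 <= w -> s ^+ 2 * ((p + r) ^+ 2 + w) <= 1 -> 0 <= edge s t r (4 * r * p).
Proof.
move=> s0 t0 r0 hr w0 ha.
have hp : s * (p + r) <= 1.
  apply: (le_trans (ler_norm _)); rewrite -(ler_pXn2r (n := 2)) ?nnegrE //.
  rewrite expr1n -normrX ger0_norm ?sqr_ge0 //.
  have := mulr_ge0 (sqr_ge0 s) w0; lra.
have s0' := ltW s0; have t0' := ltW t0; have r0' := ltW r0.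
have k0 : 0 <= (s / 2 + t) * (4 * r * s).
  by rewrite mulr_ge0 ?addr_ge0 ?divr_ge0 // !mulr_ge0.
have h1 := ler_wpM2l k0 hp.
have q0 : 0 <= 1 - 2 * r * s by rewrite subr_ge0.
have h2 : 0 <= (1 - 2 * r * s) * (s + t * (1 - 2 * r * s)).
  by rewrite mulr_ge0 // addr_ge0 // mulr_ge0.
rewrite /edge; lra.
Qed.

(** The difference a b - <u, v>^2, with u = x - x1* and v = x - x2*, is 4 r^2
    times the squared distance to the axis.  If it vanishes together with the
    gap, then |s u + t v| = 0, so u and v are opposite with s |u| = t |v|; a
    nonnegative excess then forces both to be 1, and the spheres would touch
    at x. *)
Lemma gap0_off_axis s t r a b : 0 < s -> 0 < t -> 0 < r ->
  2 * r * s * t < s + t -> 0 < a -> 0 < b ->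
  s ^+ 2 * a <= 1 -> t ^+ 2 * b <= 1 ->
  gap s t r a b = 0 -> focal_dot r a b ^+ 2 <= a * b ->
  focal_dot r a b ^+ 2 < a * b.
Proof.
move=> s0 t0 r0 /(overlap_sqr s0 t0 r0) hr a0 b0 ha hb hg.
rewrite le_eqVlt => /orP[/eqP hd|//]; exfalso.
have ca : 0 <= sinsq s a by rewrite mulr_ge0 ?subr_ge0 // ltW.
have cb : 0 <= sinsq t b by rewrite mulr_ge0 ?subr_ge0 // ltW.
have [hn hn2] := gap_eq0_sqr ca cb hg.
have ab0 : 0 < a * b by rewrite mulr_gt0.
set f := focal_dot r a b in hd hn hn2 *.
have hq : s ^+ 2 * a + t ^+ 2 * b + 2 * s * t * f = 0.
  have : a * b * (s ^+ 2 * a + t ^+ 2 * b + 2 * s * t * f) = 0.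
    move: hn2; rewrite /excess -/f /sinsq => hn2; lra.
  by move/eqP; rewrite mulf_eq0 (gt_eqF ab0) /= => /eqP.
have hs : s ^+ 2 * a = t ^+ 2 * b.
  have : (s ^+ 2 * a - t ^+ 2 * b) ^+ 2 = 0.
    have h4 : (s ^+ 2 * a + t ^+ 2 * b) ^+ 2 = (2 * s * t * f) ^+ 2.
      have -> : s ^+ 2 * a + t ^+ 2 * b = - (2 * s * t * f) by lra.
      by rewrite sqrrN.
    have h5 : s ^+ 2 * t ^+ 2 * f ^+ 2 = s ^+ 2 * t ^+ 2 * (a * b) by rewrite hd.
    lra.
  by move/eqP; rewrite expf_eq0 /= subr_eq0 => /eqP.
have hf : s * t * f = - (t ^+ 2 * b) by lra.
have h1 : t ^+ 2 * b = 1.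
  apply: le_anti; rewrite hb /=.
  have h5 : 0 <= s * t * excess s t r a b by rewrite !mulr_ge0 // ltW.
  have h6 : s * t * excess s t r a b = t ^+ 2 * b * (t ^+ 2 * b - 1).
    rewrite /excess -/f mulrDr hf -[in RHS]hs.
    have -> : s * t * (s * t * (a * b)) = s ^+ 2 * a * (t ^+ 2 * b) by ring.
    by rewrite hs; ring.
  by move: h5; rewrite h6 pmulr_rge0 ?subr_ge0 // mulr_gt0 ?exprn_gt0.
have h2 : (s + t) ^+ 2 = 4 * r ^+ 2 * s ^+ 2 * t ^+ 2.
  have hf2 : s * t * (s * t * ((a + b) / 2 - 2 * r ^+ 2)) = - (s * t).
    by rewrite -[_ / 2 - _]/f hf h1 mulrN mulr1.
  have e1 : s ^+ 2 * a * t ^+ 2 = t ^+ 2 by rewrite hs h1 mul1r.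
  have e2 : t ^+ 2 * b * s ^+ 2 = s ^+ 2 by rewrite h1 mul1r.
  lra.
by rewrite h2 ltxx in hr.
Qed.

(** The polynomial sinsq s a * sinsq t b - excess ^ 2 is quadratic in a. Being
    zero at a, its value at a - u is exactly u (D - u k), where D is minus its
    derivative. *)
Lemma gap0_descent_left s t r a b : 0 < s -> 0 < t ->
  0 < a -> s ^+ 2 * a <= 1 -> 0 <= b -> t ^+ 2 * b <= 1 ->
  excess s t r a b ^+ 2 = sinsq s a * sinsq t b ->
  0 < 2 * excess s t r a b * (1 / 2 + s * t * b)
      - (1 - 2 * s ^+ 2 * a) * sinsq t b ->
  exists2 e, 0 < e & forall u, 0 < u < e -> 0 < a - u /\ gap s t r (a - u) b < 0.
Proof.
move=> s0 t0 a0 ha b0 hb hn; set D := (X in 0 < X) => D0.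
have cb : 0 <= sinsq t b by rewrite mulr_ge0 ?subr_ge0 // ltW.
pose k := s ^+ 2 * sinsq t b + (1 / 2 + s * t * b) ^+ 2.
have k0 : 0 < k.
  apply: ltr_wpDl; first by rewrite mulr_ge0 ?sqr_ge0.
  apply: exprn_gt0; apply: ltr_pwDl; first by rewrite divr_gt0.
  by rewrite mulr_ge0 // mulr_ge0 // ltW.
exists (Num.min a (D / k)); first by rewrite lt_min a0 divr_gt0.
move=> u /andP[u0]; rewrite lt_min => /andP[ua uk].
have au : 0 < a - u by rewrite subr_gt0.
split=> //; apply: gap_lt0_sqr.
  rewrite mulr_ge0 ?(ltW au) // subr_ge0 (le_trans _ ha) // ler_wpM2l ?sqr_ge0 //.
  lra.
have : 0 < u * (D - u * k) by rewrite mulr_gt0 // subr_gt0 -ltr_pdivlMr.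
have -> : u * (D - u * k) =
   sinsq s (a - u) * sinsq t b - excess s t r (a - u) b ^+ 2
   - (sinsq s a * sinsq t b - excess s t r a b ^+ 2).
  by rewrite /D /k /excess /focal_dot /sinsq; field.
by rewrite hn subrr subr0 subr_gt0.
Qed.

(** If neither descent worked, both partial derivatives of
    sinsq s a * sinsq t b - excess ^ 2 would be nonnegative.  For a positive
    excess N this gives N < sinsq t b and N < sinsq s a, contradicting
    N ^ 2 = sinsq s a * sinsq t b.  If N = 0, the point is on both spheres,
    where the overlap makes N positive. *)
Lemma gap0_descent s t r a b : 0 < s -> 0 < t -> 0 < r ->
  2 * r * s * t < s + t -> 0 < a -> 0 < b ->
  s ^+ 2 * a <= 1 -> t ^+ 2 * b <= 1 -> gap s t r a b = 0 ->
  (exists2 e, 0 < e & forall u, 0 < u < e -> 0 < a - u /\ gap s t r (a - u) b < 0)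
  \/
  (exists2 e, 0 < e & forall u, 0 < u < e -> 0 < b - u /\ gap s t r a (b - u) < 0).
Proof.
move=> s0 t0 r0 hr a0 b0 ha hb hg.
have ca : 0 <= sinsq s a by rewrite mulr_ge0 ?subr_ge0 // ltW.
have cb : 0 <= sinsq t b by rewrite mulr_ge0 ?subr_ge0 // ltW.
have [hn hn2] := gap_eq0_sqr ca cb hg.
pose Da := 2 * excess s t r a b * (1 / 2 + s * t * b)
      - (1 - 2 * s ^+ 2 * a) * sinsq t b.
pose Db := 2 * excess s t r a b * (1 / 2 + s * t * a)
      - (1 - 2 * t ^+ 2 * b) * sinsq s a.
have [hD|hDa] := ltP 0 Da.
  by left; apply: (gap0_descent_left (t := t)) => //; apply: ltW.
have [hD|hDb] := ltP 0 Db.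
  right.
  have [||e e0 he] := @gap0_descent_left t s r b a t0 s0 b0 hb (ltW a0) ha.
  - by rewrite -excessC hn2 mulrC.
  - by rewrite -excessC [t * s]mulrC.
  by exists e => // u /he; rewrite -gapC.
exfalso.
have hst : 0 < s * t by rewrite mulr_gt0.
have ga : 1 < 1 + 2 * (s * t * a) by rewrite ltrDl !mulr_gt0.
have gb : 1 < 1 + 2 * (s * t * b) by rewrite ltrDl !mulr_gt0.
have la : 1 - 2 * s ^+ 2 * a < 1.
  by rewrite ltrBlDr ltrDl !mulr_gt0 ?exprn_gt0.
have lb : 1 - 2 * t ^+ 2 * b < 1.
  by rewrite ltrBlDr ltrDl !mulr_gt0 ?exprn_gt0.
set N := excess s t r a b in hn hn2 Da Db hDa hDb.
have ia : N * (1 + 2 * (s * t * b)) <= (1 - 2 * s ^+ 2 * a) * sinsq t b.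
  by move: hDa; rewrite /Da; lra.
have ib : N * (1 + 2 * (s * t * a)) <= (1 - 2 * t ^+ 2 * b) * sinsq s a.
  by move: hDb; rewrite /Db; lra.
move: hn; rewrite le_eqVlt => /orP[/eqP N0|N0].
  have : sinsq s a = 0 \/ sinsq t b = 0.
    have /eqP : sinsq s a * sinsq t b = 0 by rewrite -hn2 -N0 expr0n.
    by rewrite mulf_eq0 => /orP[/eqP|/eqP]; [left | right].
  have za : sinsq s a = 0 -> s ^+ 2 * a = 1.
    by move/eqP; rewrite mulf_eq0 (gt_eqF a0) /= subr_eq0 => /eqP.
  have zb : sinsq t b = 0 -> t ^+ 2 * b = 1.
    by move/eqP; rewrite mulf_eq0 (gt_eqF b0) /= subr_eq0 => /eqP.
  have sa : sinsq s a = 0 -> sinsq t b = 0.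
    move=> h; move: ia; rewrite -N0 mul0r -mulrA (za h) => h2; lra.
  have sb : sinsq t b = 0 -> sinsq s a = 0.
    move=> h; move: ib; rewrite -N0 mul0r -mulrA (zb h) => h2; lra.
  move=> zz; have {zz} [/za ea /zb eb] : sinsq s a = 0 /\ sinsq t b = 0.
    by case: zz => h; split => //; [exact: sa | exact: sb].
  have := overlap_sqr s0 t0 r0 hr.
  have e1 : s ^+ 2 * a * t ^+ 2 = t ^+ 2 by rewrite ea mul1r.
  have e2 : t ^+ 2 * b * s ^+ 2 = s ^+ 2 by rewrite eb mul1r.
  have e3 : s * t * (s ^+ 2 * a * (t ^+ 2 * b)) = s * t by rewrite ea eb !mulr1.
  have : s ^+ 2 * t ^+ 2 * N = 0 by rewrite -N0 mulr0.
  rewrite /N /excess /focal_dot; lra.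
have NA : N < sinsq t b.
  have i1 : N < N * (1 + 2 * (s * t * b)) by rewrite ltr_pMr.
  by rewrite (lt_le_trans i1) // (le_trans ia) // ler_piMl // ltW.
have NB : N < sinsq s a.
  have i1 : N < N * (1 + 2 * (s * t * a)) by rewrite ltr_pMr.
  by rewrite (lt_le_trans i1) // (le_trans ib) // ler_piMl // ltW.
have : N ^+ 2 < sinsq s a * sinsq t b by rewrite expr2 ltr_pM // ltW.
by rewrite hn2 ltxx.
Qed.
End RadialCoordinates.

(** * Pointwise continuity and points of the axis *)

Lemma axis_ptE (R : realType) n (p : R) : axis_pt n p = p *: axis_pt n 1.
Proof. by apply/rowP => j; rewrite !mxE; case: ifP => _; rewrite ?mulr1 ?mulr0. Qed.

Section PointwiseContinuity.
Variables (R : realType) (T : topologicalType) (x : T).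
Implicit Types (f g : T -> R) (V : normedModType R).

(** Limit rules with the operations under the binder, as the formulas below
    produce them. *)
Lemma continuous_at_cst (U : topologicalType) (k : U) : continuous_at x (fun=> k).
Proof. exact: cst_continuous. Qed.

Lemma continuous_at_add (V : normedModType R) (f g : T -> V) :
  continuous_at x f -> continuous_at x g -> continuous_at x (fun z => f z + g z).
Proof. exact: continuousD. Qed.

Lemma continuous_at_sub f g : continuous_at x f -> continuous_at x g ->
  continuous_at x (fun z => f z - g z).
Proof. exact: continuousB. Qed.

Lemma continuous_at_mul f g : continuous_at x f -> continuous_at x g ->
  continuous_at x (fun z => f z * g z).
Proof. exact: continuousM. Qed.

Lemma continuous_at_scale (V : normedModType R) f (v : V) : continuous_at x f ->
  continuous_at x (fun z => f z *: v).
Proof. exact: continuousZr_tmp. Qed.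

Lemma continuous_at_sqrt f :
  continuous_at x f -> continuous_at x (fun z => Num.sqrt (f z)).
Proof. by move=> cf; apply: (continuous_comp cf); exact: sqrt_continuous. Qed.

Lemma continuous_at_axis n f : continuous_at x f ->
  continuous_at x (fun z => axis_pt n (f z)).
Proof.
move=> cf; have -> : (fun z => axis_pt n (f z)) = fun z => f z *: axis_pt n 1.
  by apply/funext => z; exact: axis_ptE.
exact: continuous_at_scale.
Qed.
End PointwiseContinuity.

(** * Balls centred on the axis and coordinates by radii *)

Section AxialGeometry.
Variables (R : realType) (n : nat).
Local Notation E := 'rV[R]_n.+1.
Implicit Types (x : E) (c s t u p : R).

Definition sqdist c x : R := dotp (x - axis_pt n c) (x - axis_pt n c).
Definition sqtail x : R := dotp (col' ord0 x) (col' ord0 x).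

Lemma dotp_ge0 m (u : 'rV[R]_m) : 0 <= dotp u u.
Proof. by apply: sumr_ge0 => j _; rewrite -expr2 sqr_ge0. Qed.

Lemma dotpZ m (k : R) (u : 'rV[R]_m) : dotp (k *: u) (k *: u) = k ^+ 2 * dotp u u.
Proof.
by rewrite /dotp big_distrr; apply: eq_bigr => j _; rewrite !mxE expr2 mulrACA.
Qed.

Lemma sqdistE c x : sqdist c x = (x 0 0 - c) ^+ 2 + sqtail x.
Proof.
rewrite /sqdist /sqtail /dotp big_ord_recl !mxE /= expr2; congr (_ + _).
by apply: eq_bigr => j _; rewrite !mxE /= subr0.
Qed.

Lemma sqdist_ge0 c x : 0 <= sqdist c x.
Proof. exact: dotp_ge0. Qed.

Lemma sqtail_move k x p : sqtail (k *: x + axis_pt n p) = k ^+ 2 * sqtail x.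
Proof.
rewrite /sqtail -dotpZ; congr dotp; apply/rowP => j;
  by rewrite !mxE /= addr0.
Qed.

Lemma sqtail_axis p : sqtail (axis_pt n p) = 0.
Proof. by have := sqtail_move 0 0 p; rewrite scale0r add0r expr0n mul0r. Qed.

Lemma axis_eq x p : (x = axis_pt n p) <-> (x 0 0 = p /\ sqtail x = 0).
Proof.
split=> [->|[xp wx]]; first by rewrite sqtail_axis mxE.
apply/rowP => j; rewrite !mxE; case: (unliftP ord0 j) => [i ->|->] //=.
have /psumr_eq0P : forall k : 'I_n, true -> 0 <= (col' ord0 x) 0 k * (col' ord0 x) 0 k.
  by move=> k _; rewrite -expr2 sqr_ge0.
move/(_ wx i isT)/eqP; rewrite mulf_eq0 orbb mxE => /eqP <-.
by [].
Qed.

Lemma sqdist_axis c p : sqdist c (axis_pt n p) = (p - c) ^+ 2.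
Proof. by rewrite sqdistE sqtail_axis addr0 mxE. Qed.

Lemma sqdist_eq0 c x : (sqdist c x = 0) <-> (x = axis_pt n c).
Proof.
rewrite axis_eq sqdistE; split=> [/eqP|[-> ->]]; last by rewrite subrr expr0n addr0.
rewrite paddr_eq0 ?sqr_ge0 ?dotp_ge0 // sqrf_eq0 subr_eq0.
by case/andP=> /eqP -> /eqP.
Qed.

Lemma sqdist_radial c x u :
  sqdist c (x + u *: (x - axis_pt n c)) = (1 + u) ^+ 2 * sqdist c x.
Proof.
rewrite /sqdist -dotpZ scalerDl scale1r.
by rewrite [x + u *: _ - _]addrAC.
Qed.

Lemma coord0_continuous : continuous (fun x : E => x 0 0).
Proof. exact: coord_continuous. Qed.

Lemma sqdist_continuous c : continuous (sqdist c).
Proof.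
have -> : sqdist c = fun x => \sum_(j < n.+1)
    (x 0 j - axis_pt n c 0 j) * (x 0 j - axis_pt n c 0 j).
  by apply/funext => x; apply: eq_bigr => j _; rewrite !mxE.
apply: continuous_big => [|j _]; first exact: add_continuous.
move=> x; have cj : {for x, continuous (fun z : E => z 0 j - axis_pt n c 0 j)}.
  by apply: continuous_at_sub; [exact: coord_continuous | exact: continuous_at_cst].
exact: (continuous_at_mul cj cj).
Qed.

(** All limit points below are reached along explicit curves. *)
Lemma closure_curve (f : R -> E) (S : set E) (e : R) : continuous_at 0 f ->
  0 < e -> (forall u, 0 < u < e -> S (f u)) -> closure S (f 0).
Proof.
move=> cf e0 Sf B /cf /nbhs_ballP [d d0 dB].
have m0 : 0 < Num.min d e by rewrite lt_min d0.
have h : 0 < Num.min d e / 2 by rewrite divr_gt0.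
have h2 : Num.min d e / 2 < Num.min d e by rewrite ltr_pdivrMr // ltr_pMr // ltr1n.
exists (f (Num.min d e / 2)); split.
  by apply: Sf; rewrite h (lt_le_trans h2) // ge_min lexx orbT.
apply: dB; rewrite /= /ball /= sub0r normrN gtr0_norm //.
by rewrite (lt_le_trans h2) // ge_min lexx.
Qed.

Lemma line_continuous (x y : E) : continuous (fun u : R => x + u *: y).
Proof.
move=> u; apply: continuous_at_add; first exact: continuous_at_cst.
by apply: continuous_at_scale; exact: cvg_id.
Qed.

Lemma closed_le_fun (f : E -> R) k : continuous f -> closed [set x | f x <= k].
Proof. by move=> /continuous_closedP/(_ _ (@closed_le _ k)). Qed.

Lemma closed_ge_fun (f : E -> R) k : continuous f -> closed [set x | k <= f x].
Proof. by move=> /continuous_closedP/(_ _ (@closed_ge _ k)). Qed.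

Lemma open_lt_fun (f : E -> R) k : continuous f -> open [set x | f x < k].
Proof. by move=> /continuousP/(_ _ (@open_lt _ k)). Qed.

(** Balls of radius 1/s; the polynomial form of the inequality matches the
    constraints of the radial coordinates. *)
Definition oball s c : set E := [set x | s ^+ 2 * sqdist c x < 1].
Definition cball s c : set E := [set x | s ^+ 2 * sqdist c x <= 1].

Lemma scaled_sqdist_continuous s c : continuous (fun x => s ^+ 2 * sqdist c x).
Proof.
move=> x; apply: (@continuous_at_mul _ _ x (fun=> s ^+ 2) (sqdist c)).
  exact: continuous_at_cst.
exact: sqdist_continuous.
Qed.

Lemma open_oball s c : open (oball s c).
Proof. exact/open_lt_fun/scaled_sqdist_continuous. Qed.

Lemma closed_cball s c : closed (cball s c).
Proof. exact/closed_le_fun/scaled_sqdist_continuous. Qed.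

Lemma closure_oball s c : closure (oball s c) = cball s c.
Proof.
apply/seteqP; split.
  rewrite [X in _ `<=` X](closure_id _).1; last exact: closed_cball.
  by apply: closureS => x; apply: ltW.
move=> x hx; pose f u := x + u *: (axis_pt n c - x).
have -> : x = f 0 by rewrite /f scale0r addr0.
apply: (closure_curve (e := 1)); [exact: line_continuous | exact: ltr01 |].
move=> u /andP[u0 u1]; rewrite /oball /=.
have -> : f u = x + (- u) *: (x - axis_pt n c) by rewrite /f scaleNr -scalerN opprB.
rewrite sqdist_radial mulrCA.
have q0 : 0 <= s ^+ 2 * sqdist c x by rewrite mulr_ge0 ?sqr_ge0 ?sqdist_ge0.
have k1 : (1 - u) ^+ 2 < 1 by rewrite expr_lt1 //; lra.
by apply: le_lt_trans k1; rewrite ler_piMr ?sqr_ge0.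
Qed.

(** The radial half-line through x leaves the ball at x. *)
Lemma sphere_not_interior s c (S : set E) x :
  S `<=` cball s c -> s ^+ 2 * sqdist c x = 1 -> ~ (S°) x.
Proof.
move=> sub hx /(interiorS sub); rewrite -[cball s c]setCK interiorC; apply.
pose f u := x + u *: (x - axis_pt n c).
have -> : x = f 0 by rewrite /f scale0r addr0.
apply: (closure_curve (e := 1)); [exact: line_continuous | exact: ltr01 |].
move=> u /andP[u0 u1]; rewrite /cball /= /f sqdist_radial mulrCA hx mulr1.
by apply/negP; rewrite -ltNge expr_gt1 //; lra.
Qed.

Lemma interior_oball s c : (oball s c)° = oball s c.
Proof. exact/interior_id/open_oball. Qed.

Lemma boundary_oball s c : boundary (oball s c) = [set x | s ^+ 2 * sqdist c x = 1].
Proof.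
rewrite /boundary closure_oball interior_oball; apply/seteqP; split=> x /=.
  by case=> hx /negP; rewrite -leNgt => hx'; apply: le_anti; apply/andP.
by rewrite /cball /oball /= => ->; rewrite ltxx lexx.
Qed.

Lemma coord_radii r x : 4 * r * x 0 0 = sqdist (- r) x - sqdist r x.
Proof. by rewrite !sqdistE; ring. Qed.

Lemma sqtail_radii r x : 4 * r ^+ 2 * sqtail x =
  sqdist (- r) x * sqdist r x - focal_dot r (sqdist (- r) x) (sqdist r x) ^+ 2.
Proof. by rewrite !sqdistE /focal_dot; field. Qed.

(** The point of the half-plane through the axis and x whose squared distances to
    the foci are a and b: its first coordinate and squared distance w to the
    axis are solved from a and b, and the remaining coordinates of x are
    rescaled, which requires x to be off the axis. *)
Definition set_radii r x a b : E :=
  let p := (a - b) / (4 * r) in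
  let w := (a * b - focal_dot r a b ^+ 2) / (4 * r ^+ 2) in
  let k := Num.sqrt (w / sqtail x) in
  k *: x + axis_pt n (p - k * x 0 0).

Lemma set_radiiK r x a b : 0 < r -> 0 < sqtail x ->
  focal_dot r a b ^+ 2 <= a * b ->
  sqdist (- r) (set_radii r x a b) = a /\ sqdist r (set_radii r x a b) = b.
Proof.
move=> r0 w0 hd; rewrite !sqdistE /set_radii; cbv zeta; rewrite sqtail_move.
set p := (a - b) / _; set w := _ / (4 * _).
have hw : 0 <= w.
  by rewrite divr_ge0 ?subr_ge0 // mulr_ge0 ?sqr_ge0.
rewrite sqr_sqrtr; last by rewrite divr_ge0 ?(ltW w0).
rewrite divfK ?gt_eqF // !mxE /= addrC subrK.
by rewrite /p /w /focal_dot; split; field; rewrite gt_eqF.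
Qed.

Lemma set_radii_id r x : 0 < r -> 0 < sqtail x ->
  set_radii r x (sqdist (- r) x) (sqdist r x) = x.
Proof.
move=> r0 w0; rewrite /set_radii; cbv zeta; rewrite -sqtail_radii -coord_radii.
rewrite [4 * r ^+ 2 * _]mulrC mulfK; last by rewrite mulf_neq0 ?expf_neq0 ?gt_eqF.
rewrite divff ?gt_eqF // sqrtr1 scale1r mul1r.
rewrite [4 * r * _]mulrC mulfK ?mulf_neq0 ?gt_eqF // subrr axis_ptE scale0r.
exact: addr0.
Qed.

Lemma set_radii_continuous r x (a b : R -> R) u0 :
  continuous_at u0 a -> continuous_at u0 b ->
  continuous_at u0 (fun u => set_radii r x (a u) (b u)).
Proof.
move=> ca cb.
have cp : continuous_at u0 (fun u => (a u - b u) / (4 * r)).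
  by apply: continuous_at_mul; [apply: continuous_at_sub | exact: continuous_at_cst].
have cf : continuous_at u0 (fun u => focal_dot r (a u) (b u)).
  apply: continuous_at_sub; last exact: continuous_at_cst.
  by apply: continuous_at_mul; [apply: continuous_at_add | exact: continuous_at_cst].
have ck : continuous_at u0 (fun u => Num.sqrt
  ((a u * b u - focal_dot r (a u) (b u) ^+ 2) / (4 * r ^+ 2) / sqtail x)).
  apply: continuous_at_sqrt.
  apply: continuous_at_mul; last exact: continuous_at_cst.
  apply: continuous_at_mul; last exact: continuous_at_cst.
  by apply: continuous_at_sub; [apply: continuous_at_mul | apply: continuous_at_mul].
rewrite /set_radii; cbv zeta.
apply: continuous_at_add; first exact: continuous_at_scale ck.
apply: continuous_at_axis; apply: continuous_at_sub => //.
by apply: continuous_at_mul => //; exact: continuous_at_cst.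
Qed.
End AxialGeometry.

(** * Interior and boundary of the region of negative gap *)

Section Region.
Variables (R : realType) (n : nat).
Local Notation E := 'rV[R]_n.+1.
Implicit Types (x : E) (r s t : R).

Definition lens r s t : set E := cball s (- r) `&` cball t r.
Definition gapf r s t x := gap s t r (sqdist (- r) x) (sqdist r x).
Definition region r s t : set E := lens r s t `&` [set x | gapf r s t x < 0].

(** Replacing r by -r exchanges the foci, so that a statement about the first
    focus or sphere also yields the one about the second. *)
Lemma gapf_swap r s t : gapf (- r) t s = gapf r s t.
Proof.
apply/funext => x; rewrite /gapf gapC opprK.
by rewrite /gap /excess /focal_dot sqrrN.
Qed.

Lemma lens_swap r s t : lens (- r) t s = lens r s t.
Proof. by rewrite /lens opprK setIC. Qed.

Lemma region_swap r s t : region (- r) t s = region r s t.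
Proof. by rewrite /region gapf_swap lens_swap. Qed.

Lemma gapf_continuous r s t : continuous (gapf r s t).
Proof.
have ca := @sqdist_continuous R n (- r); have cb := @sqdist_continuous R n r.
have csinsq (k : R) (f : E -> R) x : continuous_at x f ->
    continuous_at x (fun z => sinsq k (f z)).
  move=> cf; apply: continuous_at_mul => //.
  apply: continuous_at_sub; first exact: continuous_at_cst.
  by apply: continuous_at_mul => //; exact: continuous_at_cst.
move=> x; apply: continuous_at_sub; last first.
  by apply: continuous_at_mul; apply: continuous_at_sqrt; apply: csinsq.
apply: continuous_at_add.
  apply: continuous_at_sub; last exact: continuous_at_cst.
  by apply: continuous_at_mul; [apply: continuous_at_add | exact: continuous_at_cst].
by apply: continuous_at_mul; [exact: continuous_at_cst | apply: continuous_at_mul].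
Qed.

Lemma closed_lens r s t : closed (lens r s t).
Proof. by apply: closedI; exact: closed_cball. Qed.

Lemma focal_dot_sqr_le r x :
  focal_dot r (sqdist (- r) x) (sqdist r x) ^+ 2 <= sqdist (- r) x * sqdist r x.
Proof.
by rewrite -subr_ge0 -sqtail_radii mulr_ge0 ?dotp_ge0 // mulr_ge0 ?sqr_ge0.
Qed.

Lemma gapf_focus r s t : gapf r s t (axis_pt n (- r)) = 0.
Proof.
rewrite /gapf !sqdist_axis /gap /excess /focal_dot /sinsq subrr expr0n /= !(mul0r, mulr0).
by rewrite sqrtr0 mul0r; field.
Qed.

(** Next to the focus, at distance u |r| on the segment between the foci, the
    excess is -r^2 u (2 - u) (1 - s t r^2 u (2 - u)), which is negative for
    small u. *)
Lemma focus_closure r s t : r != 0 -> 0 < s -> 0 < t ->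
  lens r s t (axis_pt n (- r)) -> closure (region r s t) (axis_pt n (- r)).
Proof.
move=> rn0 s0 t0 [_]; rewrite /cball /= sqdist_axis => ht.
pose f (u : R) : E := axis_pt n (u * r - r).
have -> : axis_pt n (- r) = f 0 by rewrite /f mul0r add0r.
have nr0 : 0 < `|r| by rewrite normr_gt0.
have r20 : 0 < r ^+ 2 by rewrite lt0r sqrf_eq0 rn0 sqr_ge0.
have k0 : 0 < 2 * s * t * r ^+ 2 by do 3!apply: mulr_gt0 => //.
(* The second bound keeps the point in the first ball, and the third one keeps
   the last factor of the excess positive. *)
pose e := Num.min 1 (Num.min (s * `|r|)^-1 (2 * s * t * r ^+ 2)^-1).
apply: (closure_curve (e := e)).
- apply: continuous_at_axis; apply: continuous_at_sub; last exact: continuous_at_cst.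
  by apply: continuous_at_mul; [exact: cvg_id | exact: continuous_at_cst].
- by rewrite !lt_min !invr_gt0 k0 ltr01 mulr_gt0.
move=> u /andP[u0]; rewrite !lt_min => /and3P[u1 us uk].
have su : u * (s * `|r|) < 1 by rewrite -ltr_pdivlMr ?div1r // mulr_gt0.
have ku : u * (2 * s * t * r ^+ 2) < 1 by rewrite -ltr_pdivlMr // div1r.
have q1 : s ^+ 2 * (u * r - r - - r) ^+ 2 <= 1.
  have -> : s ^+ 2 * (u * r - r - - r) ^+ 2 = (u * (s * `|r|)) ^+ 2.
    by rewrite !exprMn -normrX ger0_norm ?sqr_ge0 //; ring.
  by rewrite expr_le1 ?(ltW su) // !mulr_ge0 // ltW.
have q2 : t ^+ 2 * (u * r - r - r) ^+ 2 <= 1.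
  apply: le_trans ht; apply: ler_wpM2l; first exact: sqr_ge0.
  rewrite -subr_ge0.
  have -> : (- r - r) ^+ 2 - (u * r - r - r) ^+ 2 = r ^+ 2 * (u * (4 - u)) by ring.
  by apply: mulr_ge0; [exact: sqr_ge0 | apply: mulr_ge0; lra].
split; first by split; rewrite /cball /= sqdist_axis.
rewrite /= /gapf !sqdist_axis; apply: gap_lt0_excess.
have v0 : 0 < r ^+ 2 * (u * (2 - u)).
  by do 2!apply: mulr_gt0 => //; lra.
have -> : excess s t r ((u * r - r - - r) ^+ 2) ((u * r - r - r) ^+ 2)
  = - (r ^+ 2 * (u * (2 - u))) * (1 - s * t * (r ^+ 2 * (u * (2 - u)))).
  by rewrite /excess /focal_dot; field.
rewrite mulNr oppr_lt0 mulr_gt0 // subr_gt0 (le_lt_trans _ ku) //.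
have := mulr_ge0 (mulr_ge0 (ltW s0) (ltW t0)) (sqr_ge0 (u * r)); lra.
Qed.

Definition sphere_cap r s t : set E :=
  [set x | s ^+ 2 * sqdist (- r) x = 1 /\
           edge s t r (sqdist (- r) x - sqdist r x) < 0].

(** At a focus this is [focus_closure].  Elsewhere x is off the axis, and
    decreasing the right one of the two radii moves x into the region without
    leaving either ball. *)
Lemma gapf0_closure r s t x : 0 < r -> 0 < s -> 0 < t ->
  2 * r * s * t < s + t -> lens r s t x -> gapf r s t x = 0 ->
  closure (region r s t) x.
Proof.
move=> r0 s0 t0 hr Kx gx; have [sa tb] := Kx; rewrite /cball /= in sa tb.
have rn0 : r != 0 by rewrite gt_eqF.
have [a0|an0] := eqVneq (sqdist (- r) x) 0.
  by move: a0 Kx => /sqdist_eq0 ->; exact: focus_closure.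
have [b0|bn0] := eqVneq (sqdist r x) 0.
  move: b0 Kx => /sqdist_eq0 ->; rewrite -region_swap -lens_swap.
  have := @focus_closure (- r) t s; rewrite oppr_eq0 opprK; exact.
have a0 : 0 < sqdist (- r) x by rewrite lt0r an0 sqdist_ge0.
have b0 : 0 < sqdist r x by rewrite lt0r bn0 sqdist_ge0.
have off := gap0_off_axis s0 t0 r0 hr a0 b0 sa tb gx (focal_dot_sqr_le r x).
have w0 : 0 < sqtail x.
  have : 0 < 4 * r ^+ 2 * sqtail x by rewrite sqtail_radii subr_gt0.
  by rewrite pmulr_rgt0 // mulr_gt0 // exprn_gt0.
have near_off (h : R -> R) : continuous_at 0 h -> 0 < h 0 ->
    exists2 e, 0 < e & forall u, 0 < u < e -> 0 < h u.
  move=> ch h0; have o : nbhs (h 0) [set y | 0 < y].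
    by apply: open_nbhs_nbhs; split; [exact: open_gt | exact: h0].
  have /nbhs_ballP[e e0 he] := ch _ o.
  exists e => // u /andP[u0 ue]; apply: he.
  by rewrite /ball /= sub0r normrN gtr0_norm.
have reach (ha hb : R -> R) e : continuous_at 0 ha -> continuous_at 0 hb ->
    ha 0 = sqdist (- r) x -> hb 0 = sqdist r x -> 0 < e ->
    (forall u, 0 < u < e -> [/\ ha u <= sqdist (- r) x, hb u <= sqdist r x
       & gap s t r (ha u) (hb u) < 0]) ->
    closure (region r s t) x.
  move=> cha chb ha0 hb0 e0 he.
  pose f u := set_radii r x (ha u) (hb u).
  have -> : x = f 0 by rewrite /f ha0 hb0 set_radii_id.
  pose h u := ha u * hb u - focal_dot r (ha u) (hb u) ^+ 2.
  (* Two squared distances come from a point off the axis as long as h, their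
     Gram determinant, stays positive. *)
  have [||d d0 hd] := near_off h.
  - apply: continuous_at_sub; first by apply: continuous_at_mul.
    have cf : continuous_at 0 (fun u => focal_dot r (ha u) (hb u)).
      apply: continuous_at_sub; last exact: continuous_at_cst.
      by apply: continuous_at_mul; [apply: continuous_at_add | exact: continuous_at_cst].
    by apply: continuous_at_mul.
  - by rewrite /h ha0 hb0 subr_gt0.
  apply: (closure_curve (e := Num.min e d)); first exact: set_radii_continuous.
    by rewrite lt_min e0.
  move=> u /andP[u0]; rewrite lt_min => /andP[ue ud].
  have := hd u; rewrite u0 ud /h subr_gt0 => /(_ isT)/ltW hf.
  have hu : 0 < u < e by rewrite u0.
  have [la lb hg] := he u hu.
  have [ra rb] := set_radiiK r0 w0 hf.
  split; last by rewrite /= /gapf /f ra rb.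
  split; rewrite /cball /= /f ?ra ?rb; [apply: le_trans sa | apply: le_trans tb];
    by rewrite ler_wpM2l ?sqr_ge0.
have cdec (k : R) : continuous_at 0 (fun u : R => k - u).
  by apply: continuous_at_sub; [exact: continuous_at_cst | exact: cvg_id].
have [[e e0 he]|[e e0 he]] := gap0_descent s0 t0 r0 hr a0 b0 sa tb gx.
  apply: (reach (fun u => sqdist (- r) x - u) (fun=> sqdist r x) e) => //.
  - exact: continuous_at_cst.
  - exact: subr0.
  - by move=> u hu; have [_ hg] := he u hu; split; rewrite // gerBl; lra.
apply: (reach (fun=> sqdist (- r) x) (fun u => sqdist r x - u) e) => //.
- exact: continuous_at_cst.
- exact: subr0.
- by move=> u hu; have [_ hg] := he u hu; split; rewrite // gerBl; lra.
Qed.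

Lemma sphere_cap_region r s t : 0 < r -> 0 < s -> 0 < t ->
  2 * r * s * t < s + t ->
  sphere_cap r s t = region r s t `&` [set x | s ^+ 2 * sqdist (- r) x = 1].
Proof.
move=> r0 s0 t0 hr; apply/seteqP; split=> x; last first.
  by case=> [[_ /= hg] hx]; split => //; rewrite -(@sphere_gap_edge _ _ t r).
case=> hx he; have sa : s ^+ 2 * sqdist (- r) x <= 1 by rewrite hx.
split => //; split; last by rewrite /= /gapf sphere_gap_edge.
split => //; apply: ltW; exact: (beyond_edge_inside s0 t0 r0 hr sa (ltW he)).
Qed.

Lemma sphere_cap_swap_region r s t : 0 < r -> 0 < s -> 0 < t ->
  2 * r * s * t < s + t ->
  sphere_cap (- r) t s = region r s t `&` [set x | t ^+ 2 * sqdist r x = 1].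
Proof.
move=> r0 s0 t0 hr; apply/seteqP; split=> x; rewrite /sphere_cap /= opprK.
  case=> hx; rewrite /edge sqrrN -/(edge t s r _) => he.
  have tb : t ^+ 2 * sqdist r x <= 1 by rewrite hx.
  split => //; split; last by rewrite /= /gapf gapC sphere_gap_edge.
  split => //; apply: ltW; apply: (beyond_edge_inside t0 s0 r0 _ tb (ltW he)).
  by rewrite mulrAC addrC.
case=> [[_ /= hg] hx]; split => //; rewrite /edge sqrrN -/(edge t s r _).
by rewrite -(@sphere_gap_edge _ _ s r) // gapC.
Qed.

Lemma region_interior r s t :
  (region r s t)° = region r s t `&` (oball s (- r) `&` oball t r).
Proof.
apply/seteqP; split=> x.
  move=> hx; have [[sa tb] hg] := interior_subset hx; split; first by [].
  split; rewrite /oball /= lt_neqAle.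
    rewrite sa andbT; apply/eqP => e.
    by apply: sphere_not_interior e hx => y [[]].
  rewrite tb andbT; apply/eqP => e.
  by apply: sphere_not_interior e hx => y [[]].
have o : open ([set x | gapf r s t x < 0] `&` (oball s (- r) `&` oball t r)).
  apply: openI; first exact/open_lt_fun/gapf_continuous.
  by apply: openI; exact: open_oball.
case=> [[_ hg] [h1 h2]].
suff sub : [set x | gapf r s t x < 0] `&` (oball s (- r) `&` oball t r)
    `<=` region r s t.
  by have := interiorS sub; rewrite (interior_id _).1 //; apply.
by move=> y [? [? ?]]; split=> //; split; apply: ltW.
Qed.

Lemma region_boundary r s t : 0 < r -> 0 < s -> 0 < t -> 2 * r * s * t < s + t ->
  boundary (region r s t) = sphere_cap r s t `|` sphere_cap (- r) t s `|`
    (lens r s t `&` [set x | gapf r s t x = 0]).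
Proof.
move=> r0 s0 t0 hr; rewrite /boundary region_interior.
rewrite sphere_cap_region // sphere_cap_swap_region //.
apply/seteqP; split=> x.
  have cl : closed (lens r s t `&` [set x | gapf r s t x <= 0]).
    apply: closedI; [exact: closed_lens | exact/closed_le_fun/gapf_continuous].
  have sub : closure (region r s t) `<=`
      lens r s t `&` [set x | gapf r s t x <= 0].
    rewrite [X in _ `<=` X](closure_id _).1 //; apply: closureS => y [? /ltW ?].
    by split.
  case=> /sub [[sa tb] hg] nint.
  move: hg; rewrite /= le_eqVlt => /orP[/eqP hg|hg]; first by right.
  have rx : region r s t x by split.
  left; have [/eqP h1|h1] := boolP (s ^+ 2 * sqdist (- r) x == 1); first by left.
  have [/eqP h2|h2] := boolP (t ^+ 2 * sqdist r x == 1); first by right.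
  by exfalso; apply: nint; do !split => //; rewrite /oball /= lt_neqAle ?h1 ?h2.
case=> [[[rx h]|[rx h]]|[Kx gx]].
- by split; [exact: subset_closure | case=> _ [+ _]; rewrite /oball /= h ltxx].
- by split; [exact: subset_closure | case=> _ [_]; rewrite /oball /= h ltxx].
- split; first exact: gapf0_closure.
  by case=> [[_ +] _]; rewrite /= gx ltxx.
Qed.
End Region.

(** * The angle condition in terms of cosines *)

Section Angles.
Variable R : realType.
Implicit Types k l p r w x y : R.

Lemma le_acos x y : -1 <= x -> x <= y -> y <= 1 -> acos y <= acos x.
Proof.
move=> hx xy hy.
have bx : -1 <= x <= 1 by rewrite hx (le_trans xy).
have by_ : -1 <= y <= 1 by rewrite hy (le_trans hx).
rewrite leNgt -ltr_cos ?in_itv /= ?acos_ge0 ?acos_lepi //.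
by rewrite !acosK ?in_itv //= -leNgt.
Qed.

Lemma sqr_le1_itv x : x ^+ 2 <= 1 -> -1 <= x <= 1.
Proof. by move=> h; rewrite -ler_norml -(@expr_le1 _ 2) // real_normK ?num_real. Qed.

(** The polar angles of x seen from the two foci differ by the angle under which x
    sees the foci; the larger angle is the one at the focus with the larger
    first coordinate, so the difference is that angle and not its opposite. *)
Lemma viewing_angle p r w : 0 < r -> 0 <= w ->
  0 < (p + r) ^+ 2 + w -> 0 < (p - r) ^+ 2 + w ->
  let A := Num.sqrt ((p + r) ^+ 2 + w) in
  let B := Num.sqrt ((p - r) ^+ 2 + w) in
  let theta := acos ((p - r) / B) - acos ((p + r) / A) in
  0 <= theta <= pi /\ cos theta = (p ^+ 2 - r ^+ 2 + w) / (A * B).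
Proof.
move=> r0 w0 a0 b0 A B theta.
have A0 : 0 < A by rewrite sqrtr_gt0.
have B0 : 0 < B by rewrite sqrtr_gt0.
have AE : A ^+ 2 = (p + r) ^+ 2 + w by rewrite sqr_sqrtr // ltW.
have BE : B ^+ 2 = (p - r) ^+ 2 + w by rewrite sqr_sqrtr // ltW.
have sx : ((p + r) / A) ^+ 2 <= 1.
  by rewrite expr_div_n AE ler_pdivrMr // mul1r lerDl.
have sy : ((p - r) / B) ^+ 2 <= 1.
  by rewrite expr_div_n BE ler_pdivrMr // mul1r lerDl.
have /andP[x1 x2] := sqr_le1_itv sx; have /andP[y1 y2] := sqr_le1_itv sy.
have yx : (p - r) / B <= (p + r) / A.
  rewrite ler_pdivrMr // mulrAC ler_pdivlMr //.
  have [hm|hm] := leP (p - r) 0; have [hp|hp] := leP 0 (p + r).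
  - by apply: (@le_trans _ _ 0); [rewrite mulr_le0_ge0 // ltW | rewrite mulr_ge0 // ltW].
  - have lhs0 : 0 <= - (p + r) * B by rewrite mulr_ge0 ?ltW // oppr_gt0.
    have rhs0 : 0 <= - (p - r) * A by rewrite mulr_ge0 ?ltW // oppr_gt0; lra.
    rewrite -lerN2 -!mulNr -(ler_pXn2r (n := 2)) ?nnegrE // !exprMn AE BE.
    have pn0 : 0 <= - p by lra.
    have := mulr_ge0 (mulr_ge0 (ltW r0) w0) pn0; lra.
  - have lhs0 : 0 <= (p - r) * A by rewrite mulr_ge0 ?ltW.
    have rhs0 : 0 <= (p + r) * B by rewrite mulr_ge0 ?ltW //; lra.
    rewrite -(ler_pXn2r (n := 2)) ?nnegrE // !exprMn AE BE.
    have pn0 : 0 <= p by lra.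
    have := mulr_ge0 (mulr_ge0 (ltW r0) w0) pn0; lra.
  - by exfalso; lra.
have tx : Num.sqrt (1 - ((p + r) / A) ^+ 2) = Num.sqrt w / A.
  have -> : 1 - ((p + r) / A) ^+ 2 = w * (A^-1) ^+ 2.
    rewrite expr_div_n exprVn AE; field; lra.
  by rewrite sqrtrM // sqrtr_sqr gtr0_norm ?invr_gt0.
have ty : Num.sqrt (1 - ((p - r) / B) ^+ 2) = Num.sqrt w / B.
  have -> : 1 - ((p - r) / B) ^+ 2 = w * (B^-1) ^+ 2.
    rewrite expr_div_n exprVn BE; field; lra.
  by rewrite sqrtrM // sqrtr_sqr gtr0_norm ?invr_gt0.
split.
  rewrite subr_ge0 le_acos //=.
  have := acos_lepi (_ : -1 <= (p - r) / B <= 1); rewrite y1 y2 => /(_ isT).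
  have := acos_ge0 (_ : -1 <= (p + r) / A <= 1); rewrite x1 x2 => /(_ isT).
  rewrite /theta; lra.
rewrite /theta cosB !acosK ?in_itv /= ?x1 ?x2 ?y1 ?y2 //.
rewrite !sin_acos ?x1 ?x2 ?y1 ?y2 // tx ty.
have ww : Num.sqrt w * Num.sqrt w = w by rewrite -expr2 sqr_sqrtr.
have -> : Num.sqrt w / B * (Num.sqrt w / A) = w / (A * B).
  by rewrite mulrACA ww -invfM [B * A]mulrC.
by field; rewrite !gt_eqF.
Qed.

(** Both phi1 + phi2 and theta lie in [0, pi], so the comparison can be made on
    cosines: that of pi - (phi1 + phi2) is -cos (phi1 + phi2). *)
Lemma acos_sum_gt k l theta : 0 <= k <= 1 -> 0 <= l <= 1 -> 0 <= theta <= pi ->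
  (acos k + acos l > pi - theta) =
  (cos theta + k * l < Num.sqrt (1 - k ^+ 2) * Num.sqrt (1 - l ^+ 2)).
Proof.
move=> /andP[k0 k1] /andP[l0 l1] /andP[h0 hpi].
have m1 : forall z : R, 0 <= z -> -1 <= z by move=> z hz; lra.
have kk : -1 <= k <= 1 by rewrite k1 m1.
have ll : -1 <= l <= 1 by rewrite l1 m1.
have hk : acos k <= pi / 2 by rewrite -acos0 le_acos //; lra.
have hl : acos l <= pi / 2 by rewrite -acos0 le_acos //; lra.
have gk := acos_ge0 kk; have gl := acos_ge0 ll.
have -> : (acos k + acos l > pi - theta) = (pi - (acos k + acos l) < theta).
  by rewrite ltrBlDr -ltrBlDl.
rewrite -ltr_cos ?in_itv /=; [|lra|by rewrite h0].
have -> : pi - (acos k + acos l) = - (acos k + acos l) + pi by rewrite addrC.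
rewrite cosDpi cosN cosD !acosK ?in_itv //= !sin_acos //.
by rewrite opprB ltrBrDr.
Qed.
End Angles.

(** * The sets of the theorem in radial coordinates *)

Section Translation.
Variables (R : realType) (n : nat) (r sigma1 sigma2 L : R).
Hypotheses (r0 : 0 < r) (sigma1_0 : 0 < sigma1) (sigma2_0 : 0 < sigma2)
  (L0 : 0 < L).
Local Notation E := 'rV[R]_n.+1.
Local Notation s := (sigma1 / L).
Local Notation t := (sigma2 / L).
Local Notation a := (@sqdist R n (- r)).
Local Notation b := (@sqdist R n r).
Local Notation f1 := (axis_pt n (- r) : E).
Local Notation f2 := (axis_pt n r : E).
Implicit Types x : E.

Let s0 : 0 < s. Proof. exact: divr_gt0. Qed.
Let t0 : 0 < t. Proof. exact: divr_gt0. Qed.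

Lemma enorm_sqr m (u : 'rV[R]_m) : enorm u ^+ 2 = dotp u u.
Proof. by rewrite /enorm sqr_sqrtr // dotp_ge0. Qed.

Lemma enorm_lt m (u : 'rV[R]_m) (k : R) : 0 < k ->
  (enorm u < L / k) = ((k / L) ^+ 2 * dotp u u < 1).
Proof.
move=> k0; rewrite -enorm_sqr -exprMn expr_lt1 //; last first.
  by rewrite mulr_ge0 ?sqrtr_ge0 // divr_ge0 ?ltW.
by rewrite ltr_pdivlMr // mulrAC ltr_pdivrMr // mul1r mulrC.
Qed.

Lemma enorm_eq m (u : 'rV[R]_m) (k : R) : 0 < k ->
  enorm u = L / k -> (k / L) ^+ 2 * dotp u u = 1.
Proof. by move=> k0 h; rewrite -enorm_sqr h -exprMn; field; rewrite !gt_eqF. Qed.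

Lemma B1E : @B1 R n r sigma1 L = oball s (- r).
Proof. by apply/funext => x; rewrite /B1 /oball /= enorm_lt. Qed.

Lemma B2E : @B2 R n r sigma2 L = oball t r.
Proof. by apply/funext => x; rewrite /B2 /oball /= enorm_lt. Qed.

Lemma enorm_axis (c : R) : enorm (axis_pt n c) = `|c|.
Proof.
have := sqdist_axis n 0 c; rewrite /sqdist [axis_pt n 0]axis_ptE scale0r !subr0.
by move=> h; rewrite /enorm h sqrtr_sqr.
Qed.

Lemma foci_diff : x2s n r - x1s n r = axis_pt n (2 * r).
Proof. by apply/rowP => j; rewrite !mxE; case: ifP => _; ring. Qed.

Lemma angle_axis c x : 0 < sqdist c x ->
  angle (x - axis_pt n c) (x2s n r - x1s n r) =
  acos ((x 0 0 - c) / Num.sqrt (sqdist c x)).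
Proof.
move=> c0; rewrite /angle foci_diff enorm_axis gtr0_norm ?mulr_gt0 //.
have -> : dotp (x - axis_pt n c) (axis_pt n (2 * r)) = (x 0 0 - c) * (2 * r).
  rewrite /dotp big_ord_recl !mxE /= big1 ?addr0 // => j _.
  by rewrite !mxE /= mulr0.
rewrite -/(sqdist c x) /enorm -/(sqdist c x); congr acos.
by rewrite -mulf_div divff ?mulr1 // gt_eqF // mulr_gt0.
Qed.

Lemma angle_sum_gt_gap x : lens r s t x -> 0 < a x -> 0 < b x ->
  (phi1 r sigma1 L x + phi2 r sigma2 L x > psi r x) = (gapf r s t x < 0).
Proof.
case; rewrite /cball /= => sa tb a0 b0.
have ea : enorm (x - x1s n r) = Num.sqrt (a x) by [].
have eb : enorm (x - x2s n r) = Num.sqrt (b x) by [].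
rewrite /phi1 /phi2 /psi /alpha1 /alpha2 ea eb.
rewrite (angle_axis a0) (angle_axis b0) opprK.
have w0 : 0 <= sqtail x := dotp_ge0 _.
have aE := sqdistE (- r) x; have bE := sqdistE r x; rewrite opprK in aE.
have [] := @viewing_angle R (x 0 0) r (sqtail x) r0 w0.
- by rewrite -aE.
- by rewrite -bE.
rewrite -aE -bE => th cth.
have k01 (k c : R) : 0 < k -> k ^+ 2 * c <= 1 -> 0 < c -> 0 <= k * Num.sqrt c <= 1.
  move=> k0 h c0; rewrite mulr_ge0 ?sqrtr_ge0 ?(ltW k0) //=.
  rewrite -(@expr_le1 _ 2) ?mulr_ge0 ?sqrtr_ge0 ?(ltW k0) //.
  by rewrite exprMn sqr_sqrtr // ltW.
rewrite acos_sum_gt ?k01 // cth.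
have A0 : 0 < Num.sqrt (a x) by rewrite sqrtr_gt0.
have B0 : 0 < Num.sqrt (b x) by rewrite sqrtr_gt0.
have AE : Num.sqrt (a x) ^+ 2 = a x by rewrite sqr_sqrtr // ltW.
have BE : Num.sqrt (b x) ^+ 2 = b x by rewrite sqr_sqrtr // ltW.
have cE (k c : R) : 0 < c -> Num.sqrt (sinsq k c) =
    Num.sqrt c * Num.sqrt (1 - (k * Num.sqrt c) ^+ 2).
  by move=> c0; rewrite exprMn sqr_sqrtr ?sqrtrM ?ltW.
rewrite /gapf /gap subr_lt0 !cE //.
rewrite -[LHS](ltr_pM2l (mulr_gt0 A0 B0)); congr (_ < _); last exact: mulrACA.
have -> : x 0 0 ^+ 2 - r ^+ 2 + sqtail x = focal_dot r (a x) (b x).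
  by rewrite /focal_dot aE bE; field.
rewrite /excess; have -> : a x * b x = Num.sqrt (a x) ^+ 2 * Num.sqrt (b x) ^+ 2.
  by rewrite AE BE.
by field; rewrite !gt_eqF.
Qed.

Lemma angle_domE : angle_dom r sigma1 sigma2 L =
  lens r s t `\` [set axis_pt n (- r); axis_pt n r].
Proof. by rewrite /angle_dom B1E B2E !closure_oball. Qed.

Lemma off_foci_gt0 c x : x <> axis_pt n c -> 0 < sqdist c x.
Proof.
by move=> h; rewrite lt0r sqdist_ge0 andbT; apply/eqP => /sqdist_eq0.
Qed.

(** The gap vanishes at the foci, so the region contains neither of them. *)
Lemma TtildeE : @Ttilde R n r sigma1 sigma2 L = region r s t.
Proof.
rewrite /Ttilde angle_domE; apply/seteqP; split=> x.
  move=> [[Kx /not_orP[n1 n2]] h]; split => //=.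
  by rewrite -angle_sum_gt_gap //; exact: off_foci_gt0.
case=> [Kx gx]; have n12 : ~ [set axis_pt n (- r); axis_pt n r] x.
  case=> /= e; move: gx; rewrite e /= ?gapf_focus ?ltxx //.
  by rewrite -gapf_swap -{2}[r]opprK gapf_focus ltxx.
split; first by split.
by move/not_orP: n12 => [n1 n2]; rewrite angle_sum_gt_gap //; exact: off_foci_gt0.
Qed.

Lemma TsetE : @Tset R n r sigma1 sigma2 L =
  (lens r s t `&` [set x | gapf r s t x = 0])
    `\` [set axis_pt n (- r); axis_pt n r].
Proof.
have sq (c k : R) : 0 < c ->
    (0 <= 1 / c - k ^+ 2 / L ^+ 2) = ((k / L) ^+ 2 * c <= 1).
  by move=> c0; rewrite subr_ge0 -expr_div_n ler_pdivlMr.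
have sqE (c k : R) : 0 < c ->
    c * Num.sqrt (1 / c - k ^+ 2 / L ^+ 2) = Num.sqrt (sinsq (k / L) c).
  move=> c0; rewrite -{1}[c](gtr0_norm c0) -sqrtr_sqr -sqrtrM ?sqr_ge0 //.
  by congr Num.sqrt; rewrite /sinsq; field; rewrite !gt_eqF.
have key x : 0 < a x -> 0 < b x ->
   ((enorm x ^+ 2 - r ^+ 2) / (d1 r x ^+ 2 * d2 r x ^+ 2)
        + sigma1 * sigma2 / L ^+ 2
      = Num.sqrt (1 / d1 r x ^+ 2 - sigma1 ^+ 2 / L ^+ 2)
        * Num.sqrt (1 / d2 r x ^+ 2 - sigma2 ^+ 2 / L ^+ 2)) <->
   gapf r s t x = 0.
  move=> a0 b0; rewrite /d1 /d2 !enorm_sqr -/(sqdist (- r) x) -/(sqdist r x).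
  have -> : dotp x x - r ^+ 2 = focal_dot r (a x) (b x).
    have -> : dotp x x = sqdist 0 x
      by rewrite /sqdist [axis_pt n 0]axis_ptE scale0r subr0.
    by rewrite /focal_dot !sqdistE; field.
  have abn0 : a x * b x != 0 by rewrite mulf_neq0 ?gt_eqF.
  have e1 : a x * b x * (focal_dot r (a x) (b x) / (a x * b x)
      + sigma1 * sigma2 / L ^+ 2) = excess s t r (a x) (b x).
    by rewrite /excess; field; rewrite !gt_eqF.
  have e2 := sqE (a x) sigma1 a0; have e3 := sqE (b x) sigma2 b0.
  rewrite /gapf /gap -e1 -e2 -e3 mulrACA -mulrBr.
  split=> [->|/eqP]; first by rewrite subrr mulr0.
  by rewrite mulf_eq0 (negbTE abn0) /= subr_eq0 => /eqP.
have d1E x : d1 r x ^+ 2 = a x by rewrite /d1 enorm_sqr.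
have d2E x : d2 r x ^+ 2 = b x by rewrite /d2 enorm_sqr.
apply/seteqP; split=> x.
  case=> n1 n2; rewrite d1E d2E => h1 h2 h3.
  have a0 := off_foci_gt0 n1; have b0 := off_foci_gt0 n2.
  split; last by move=> [] /=.
  split; first by split; rewrite /cball /= -sq.
  by apply/(key x a0 b0); rewrite d1E d2E.
case=> [[[sa tb] gx] /not_orP[n1 n2]].
have a0 := off_foci_gt0 n1; have b0 := off_foci_gt0 n2.
by split => //; rewrite ?d1E ?d2E ?sq //; have /(key x a0 b0) := gx; rewrite d1E d2E.
Qed.

Lemma edge1_lambda1 x : exists2 k, 0 < k &
  edge s t r (a x - b x) = k * (lambda1 r sigma1 sigma2 L - x 0 0).
Proof.
have h0 : 0 < s / 2 + t by apply: addr_gt0 => //; apply: divr_gt0.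
exists (s ^+ 2 * (s / 2 + t) * (4 * r)).
  by apply: mulr_gt0; apply: mulr_gt0 => //; apply: exprn_gt0.
rewrite -coord_radii /edge /lambda1 /gamma1 /beta.
by field; rewrite !gt_eqF ?addr_gt0 ?mulr_gt0.
Qed.

Lemma edge2_lambda2 x : exists2 k, 0 < k &
  edge t s r (b x - a x) = k * (x 0 0 - lambda2 r sigma1 sigma2 L).
Proof.
have h0 : 0 < t / 2 + s by apply: addr_gt0 => //; apply: divr_gt0.
exists (t ^+ 2 * (t / 2 + s) * (4 * r)).
  by apply: mulr_gt0; apply: mulr_gt0 => //; apply: exprn_gt0.
rewrite -opprB -coord_radii /edge /lambda2 /gamma2 /beta.
by field; rewrite !gt_eqF ?addr_gt0 ?mulr_gt0.
Qed.

Lemma edge1_lt0 x :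
  (edge s t r (a x - b x) < 0) = (lambda1 r sigma1 sigma2 L < x 0 0).
Proof. by have [k k0 ->] := edge1_lambda1 x; rewrite pmulr_rlt0 // subr_lt0. Qed.

Lemma edge2_lt0 x :
  (edge t s r (b x - a x) < 0) = (x 0 0 < lambda2 r sigma1 sigma2 L).
Proof. by have [k k0 ->] := edge2_lambda2 x; rewrite pmulr_rlt0 // subr_lt0. Qed.

Lemma edge1_le0 x :
  (edge s t r (a x - b x) <= 0) = (lambda1 r sigma1 sigma2 L <= x 0 0).
Proof. by have [k k0 ->] := edge1_lambda1 x; rewrite pmulr_rle0 // subr_le0. Qed.

Lemma edge2_le0 x :
  (edge t s r (b x - a x) <= 0) = (x 0 0 <= lambda2 r sigma1 sigma2 L).
Proof. by have [k k0 ->] := edge2_lambda2 x; rewrite pmulr_rle0 // subr_le0. Qed.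

(** The radius nu_1 is that of the section of the sphere by the hyperplane
    x_1 = lambda1.  Both factors under the root are nonnegative
    because x2* is outside the ball and the balls overlap. *)
Lemma nu1_sqr : 1 < 2 * r * s -> 2 * r * s * t <= s + t ->
  nu1 r sigma1 sigma2 L ^+ 2 =
    L ^+ 2 / sigma1 ^+ 2 - (lambda1 r sigma1 sigma2 L + r) ^+ 2.
Proof.
move=> h1 h2; rewrite /nu1 exprMn sqr_sqrtr; last first.
  rewrite /nu1_arg /gamma1 /beta.
  have -> : L ^+ 2 / sigma1 ^+ 2 / r ^+ 2 = (r * s)^-1 ^+ 2.
    by field; rewrite !gt_eqF.
  have q0 : 0 < r * s by rewrite mulr_gt0.
  have q1 : (r * s)^-1 < 2.
    by rewrite -(ltr_pM2r q0) mulVf ?gt_eqF // [2 * (_ * _)]mulrA.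
  have q2 : 2 * (sigma2 / sigma1) <= (1 + sigma2 / sigma1) * (r * s)^-1.
    rewrite ler_pdivlMr //.
    have -> : 2 * (sigma2 / sigma1) * (r * s) = (2 * r * s * t) / s.
      by field; rewrite !gt_eqF.
    have -> : 1 + sigma2 / sigma1 = (s + t) / s by field; rewrite !gt_eqF.
    by rewrite ler_pM2r // invr_gt0.
  apply: mulr_ge0.
    rewrite oppr_ge0 subr_le0; have -> : (4 : R) = 2 ^+ 2 by ring.
    by rewrite ler_pXn2r ?nnegrE ?invr_ge0 ?ltW.
  rewrite subr_ge0 -exprMn.
  have -> : 4 * (sigma2 / sigma1) ^+ 2 = (2 * (sigma2 / sigma1)) ^+ 2 by ring.
  have z0 : 0 <= 2 * (sigma2 / sigma1) by rewrite mulr_ge0 // divr_ge0 // ltW.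
  by rewrite ler_pXn2r ?nnegrE // (le_trans z0).
rewrite /nu1_arg /gamma1 /lambda1 /gamma1 /beta.
by field; rewrite !gt_eqF ?addr_gt0 ?mulr_gt0.
Qed.

Lemma nu2_sqr : 1 < 2 * r * t -> 2 * r * s * t <= s + t ->
  nu2 r sigma1 sigma2 L ^+ 2 =
    L ^+ 2 / sigma2 ^+ 2 - (lambda2 r sigma1 sigma2 L - r) ^+ 2.
Proof.
move=> h1 h2; rewrite /nu2 exprMn sqr_sqrtr; last first.
  rewrite /nu2_arg /gamma2 /beta.
  have -> : L ^+ 2 / sigma2 ^+ 2 / r ^+ 2 = (r * t)^-1 ^+ 2.
    by field; rewrite !gt_eqF.
  have q0 : 0 < r * t by rewrite mulr_gt0.
  have q1 : (r * t)^-1 < 2.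
    by rewrite -(ltr_pM2r q0) mulVf ?gt_eqF // [2 * (_ * _)]mulrA.
  have q2 : 2 <= (1 + sigma2 / sigma1) * (r * t)^-1.
    rewrite ler_pdivlMr //.
    have -> : 2 * (r * t) = (2 * r * s * t) / s by field; rewrite !gt_eqF.
    have -> : 1 + sigma2 / sigma1 = (s + t) / s by field; rewrite !gt_eqF.
    by rewrite ler_pM2r // invr_gt0.
  have -> : (4 : R) = 2 ^+ 2 by ring.
  apply: mulr_ge0.
    by rewrite oppr_ge0 subr_le0 ler_pXn2r ?nnegrE ?invr_ge0 ?ltW.
  by rewrite subr_ge0 -exprMn ler_pXn2r ?nnegrE // (le_trans _ q2).
rewrite /nu2_arg /gamma2 /lambda2 /gamma2 /beta.
by field; rewrite !gt_eqF ?addr_gt0 ?mulr_gt0.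
Qed.

Lemma enorm_tail x (nu : R) : 0 <= nu ->
  (enorm (col' ord0 x) = nu) <-> (sqtail x = nu ^+ 2).
Proof.
move=> nu0; split=> [<-|h]; first by rewrite enorm_sqr.
by rewrite /enorm -/(sqtail x) h sqrtr_sqr ger0_norm.
Qed.

Lemma circle_on_sphere x (lam c k nu : R) : 0 < k ->
  nu ^+ 2 = L ^+ 2 / k ^+ 2 - (lam - c) ^+ 2 -> 0 <= nu ->
  (x 0 0 = lam /\ enorm (col' ord0 x) = nu) <->
  (x 0 0 = lam /\ (k / L) ^+ 2 * sqdist c x = 1).
Proof.
move=> k0 hn nu0; rewrite sqdistE.
have kL : (k / L) ^+ 2 * (L ^+ 2 / k ^+ 2) = 1 by field; rewrite !gt_eqF.
have kn0 : (k / L) ^+ 2 != 0 by rewrite expf_eq0 /= gt_eqF // divr_gt0.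
split=> [[xl /(enorm_tail x nu0) ->]|[xl h]]; split => //.
  by rewrite hn xl [_ ^+ 2 + _]addrC subrK kL.
apply/(enorm_tail x nu0); rewrite hn -xl.
by move: h; rewrite -[in X in X -> _]kL => /(mulfI kn0) <-; rewrite addrAC subrr add0r.
Qed.

Lemma C1E : 1 < 2 * r * s -> 2 * r * s * t <= s + t ->
  C1 r sigma1 sigma2 L =
  [set x : E | x 0 0 = lambda1 r sigma1 sigma2 L /\ s ^+ 2 * a x = 1].
Proof.
move=> h1 h2.
have hn : nu1 r sigma1 sigma2 L ^+ 2 =
    L ^+ 2 / sigma1 ^+ 2 - (lambda1 r sigma1 sigma2 L - - r) ^+ 2.
  by rewrite opprK nu1_sqr.
apply/funext => x; apply/propext; apply: (circle_on_sphere x sigma1_0 hn).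
rewrite /nu1 mulr_ge0 ?sqrtr_ge0 // divr_ge0 ?(ltW r0) //.
by have := divr_gt0 sigma2_0 sigma1_0; rewrite -/(beta sigma1 sigma2); lra.
Qed.

Lemma C2E : 1 < 2 * r * t -> 2 * r * s * t <= s + t ->
  C2 r sigma1 sigma2 L =
  [set x : E | x 0 0 = lambda2 r sigma1 sigma2 L /\ t ^+ 2 * b x = 1].
Proof.
move=> h1 h2; have hn := nu2_sqr h1 h2.
apply/funext => x; apply/propext; apply: (circle_on_sphere x sigma2_0 hn).
rewrite /nu2 mulr_ge0 ?sqrtr_ge0 // divr_ge0 ?(ltW r0) //.
by have := divr_gt0 sigma2_0 sigma1_0; rewrite -/(beta sigma1 sigma2); lra.
Qed.

Lemma lens_focus1 : lens r s t f1 <-> 2 * r * t <= 1.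
Proof.
rewrite /lens /cball /= !sqdist_axis subrr expr0n mulr0 ler01.
have -> : t ^+ 2 * (- r - r) ^+ 2 = (2 * r * t) ^+ 2 by ring.
have h : 0 <= 2 * r * t by rewrite !mulr_ge0 ?invr_ge0 // ltW.
by rewrite expr_le1 //; split=> [[]|].
Qed.

Lemma lens_focus2 : lens r s t f2 <-> 2 * r * s <= 1.
Proof.
rewrite /lens /cball /= !sqdist_axis subrr expr0n mulr0 ler01.
have -> : s ^+ 2 * (r - - r) ^+ 2 = (2 * r * s) ^+ 2 by ring.
have h : 0 <= 2 * r * s by rewrite !mulr_ge0 ?invr_ge0 // ltW.
by rewrite expr_le1 //; split=> [[]|].
Qed.

Lemma lens_gapf0 : lens r s t `&` [set x | gapf r s t x = 0] =
  Tset r sigma1 sigma2 L `|` ([set f1; f2] `&` lens r s t).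
Proof.
rewrite TsetE; apply/seteqP; split=> x.
  have [fx|fx] := pselect ([set f1; f2] x); last by left.
  by case=> Kx gx; right.
case=> [[]//|[fx Kx]]; split=> //.
case: fx => ->; rewrite /= ?gapf_focus //.
by rewrite -gapf_swap -{2}[r]opprK gapf_focus.
Qed.

Lemma region_before_edge1 x :
  region r s t x -> x 0 0 <= lambda1 r sigma1 sigma2 L ->
  oball s (- r) x.
Proof.
move=> [[sa _] hg] hx; rewrite /oball /= lt_neqAle [_ <= 1]sa andbT.
apply/eqP => e; move: hg; rewrite /= /gapf (sphere_gap_edge _ _ _ s0 e).
by rewrite edge1_lt0 ltNge hx.
Qed.

Lemma region_before_edge2 x :
  region r s t x -> lambda2 r sigma1 sigma2 L <= x 0 0 ->
  oball t r x.
Proof.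
move=> [[_ tb] hg] hx; rewrite /oball /= lt_neqAle [_ <= 1]tb andbT.
apply/eqP => e; move: hg; rewrite /= /gapf gapC (sphere_gap_edge _ _ _ t0 e).
by rewrite edge2_lt0 ltNge hx.
Qed.

Lemma cball_before_edge1 x : 2 * r * s <= 1 -> cball s (- r) x ->
  x 0 0 <= lambda1 r sigma1 sigma2 L.
Proof.
move=> h; rewrite /cball /= sqdistE opprK => hx.
rewrite leNgt -edge1_lt0 -leNgt -coord_radii.
exact: (edge_ge0_far_focus s0 t0 r0 h (dotp_ge0 _) hx).
Qed.

Lemma cball_before_edge2 x : 2 * r * t <= 1 -> cball t r x ->
  lambda2 r sigma1 sigma2 L <= x 0 0.
Proof.
move=> h; rewrite /cball /= sqdistE => hx.
rewrite leNgt -edge2_lt0 -leNgt -opprB -coord_radii -mulrN.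
apply: (edge_ge0_far_focus t0 s0 r0 h (dotp_ge0 (col' ord0 x))).
by rewrite [- _ + r]addrC -[(r - _) ^+ 2]sqrrN opprB.
Qed.

Section Overlapping.
Hypothesis overlap : 2 * r * s * t < s + t.

Let overlapC : 2 * r * t * s < t + s.
Proof. by rewrite mulrAC addrC. Qed.

Lemma lambda2_lt_lambda1 : lambda2 r sigma1 sigma2 L < lambda1 r sigma1 sigma2 L.
Proof.
pose x : E := axis_pt n (lambda2 r sigma1 sigma2 L).
have xE : x 0 0 = lambda2 r sigma1 sigma2 L by rewrite mxE.
rewrite ltNge -xE -edge1_le0; apply/negP => /(edges_disjoint s0 t0 r0 overlap).
by rewrite opprB ltNge edge2_le0 xE lexx.
Qed.

Lemma beyond_edge1 x : cball s (- r) x -> lambda1 r sigma1 sigma2 L <= x 0 0 ->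
  oball s (- r) x \/ lambda1 r sigma1 sigma2 L < x 0 0 ->
  region r s t x /\ oball t r x.
Proof.
rewrite -edge1_le0 -edge1_lt0 => sa he st.
have tb := beyond_edge_inside s0 t0 r0 overlap sa he.
split=> //; split; first by split=> //; exact: ltW.
exact: (beyond_edge_gap s0 t0 (sqdist_ge0 _ _) sa he st).
Qed.

Lemma beyond_edge2 x : cball t r x -> x 0 0 <= lambda2 r sigma1 sigma2 L ->
  oball t r x \/ x 0 0 < lambda2 r sigma1 sigma2 L ->
  region r s t x /\ oball s (- r) x.
Proof.
rewrite -edge2_le0 -edge2_lt0 => tb he st.
have sa := beyond_edge_inside t0 s0 r0 overlapC tb he.
split=> //; split; first by split=> //; exact: ltW.
rewrite /= /gapf gapC.
exact: (beyond_edge_gap t0 s0 (sqdist_ge0 _ _) tb he st).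
Qed.

Lemma MdownE : @Mdown R n r sigma1 sigma2 L = region r s t.
Proof.
rewrite /Mdown TtildeE; have -> : Xset r sigma1 sigma2 L = set0 :> set E; last first.
  exact: setU0.
apply/seteqP; split=> // x [+ _ _].
rewrite foci_diff enorm_axis gtr0_norm ?mulr_gt0 // => h; move: overlap.
suff -> : 2 * r * s * t = s + t by rewrite ltxx.
by rewrite h; field; rewrite !gt_eqF.
Qed.

Lemma interior_Mdown : (@Mdown R n r sigma1 sigma2 L)° =
  region r s t `&` (oball s (- r) `&` oball t r).
Proof. by rewrite MdownE region_interior. Qed.

Lemma boundary_Mdown : boundary (@Mdown R n r sigma1 sigma2 L) =
  (boundary (B1 r sigma1 L) `&` ~` H1m r sigma1 sigma2 L) `|`
  (boundary (B2 r sigma2 L) `&` ~` H2p r sigma1 sigma2 L) `|`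
  (Tset r sigma1 sigma2 L `|` ([set f1; f2] `&` lens r s t)).
Proof.
rewrite MdownE region_boundary // lens_gapf0 B1E B2E !boundary_oball.
congr (_ `|` _ `|` _); apply/seteqP; split=> x; rewrite /H1m /H2p /sphere_cap /=.
- by rewrite edge1_lt0 => -[-> h]; split=> //; apply/negP; rewrite -ltNge.
- by rewrite edge1_lt0 => -[-> /negP]; rewrite -ltNge.
- rewrite opprK /edge sqrrN -/(edge t s r _) edge2_lt0 => -[-> h].
  by split=> //; apply/negP; rewrite -ltNge.
- by rewrite opprK /edge sqrrN -/(edge t s r _) edge2_lt0 => -[-> /negP]; rewrite -ltNge.
Qed.

(** On the hyperplane and beyond it, M misses from the closed ball exactly the
    circle where hyperplane and sphere meet. *)
Lemma closed_Mdown_C1 : 1 < 2 * r * s ->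
  closed ((Mdown r sigma1 sigma2 L `|` C1 r sigma1 sigma2 L)
    `&` @H1p R n r sigma1 sigma2 L).
Proof.
move=> h1; rewrite MdownE C1E //; last exact: ltW.
suff -> : (region r s t `|` [set x : E | x 0 0 = lambda1 r sigma1 sigma2 L /\
    s ^+ 2 * a x = 1]) `&` H1p r sigma1 sigma2 L
  = cball s (- r) `&` H1p r sigma1 sigma2 L.
  by apply: closedI; [exact: closed_cball | exact/closed_ge_fun/coord0_continuous].
apply/seteqP; split=> x.
  case=> [[[[sa _] _]|[xl sa]] hx]; split=> //.
  by rewrite /cball /= sa.
case=> sa hx; split=> //; rewrite /H1p /= in hx.
have [xl|xl] := eqVneq (x 0 0) (lambda1 r sigma1 sigma2 L); last first.
  by left; apply: (beyond_edge1 sa hx _).1; right; rewrite lt_neqAle eq_sym xl.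
have [e|e] := eqVneq (s ^+ 2 * a x) 1; first by right.
by left; apply: (beyond_edge1 sa hx _).1; left; rewrite /oball /= lt_neqAle e.
Qed.

Lemma closed_Mdown_C2 : 1 < 2 * r * t ->
  closed ((Mdown r sigma1 sigma2 L `|` C2 r sigma1 sigma2 L)
    `&` @H2m R n r sigma1 sigma2 L).
Proof.
move=> h1; rewrite MdownE C2E //; last exact: ltW.
suff -> : (region r s t `|` [set x : E | x 0 0 = lambda2 r sigma1 sigma2 L /\
    t ^+ 2 * b x = 1]) `&` H2m r sigma1 sigma2 L
  = cball t r `&` H2m r sigma1 sigma2 L.
  by apply: closedI; [exact: closed_cball | exact/closed_le_fun/coord0_continuous].
apply/seteqP; split=> x.
  case=> [[[[_ tb] _]|[xl tb]] hx]; split=> //.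
  by rewrite /cball /= tb.
case=> tb hx; split=> //; rewrite /H2m /= in hx.
have [xl|xl] := eqVneq (x 0 0) (lambda2 r sigma1 sigma2 L); last first.
  by left; apply: (beyond_edge2 tb hx _).1; right; rewrite lt_neqAle xl.
have [e|e] := eqVneq (t ^+ 2 * b x) 1; first by right.
by left; apply: (beyond_edge2 tb hx _).1; left; rewrite /oball /= lt_neqAle e.
Qed.

Lemma open_Mdown_inter (A : set E) : open A ->
  (region r s t `&` A `<=` oball s (- r) `&` oball t r) ->
  open (Mdown r sigma1 sigma2 L `&` A).
Proof.
move=> oA sub; rewrite (_ : _ `&` A = (Mdown r sigma1 sigma2 L)° `&` A).
  by apply: openI => //; exact: open_interior.
rewrite interior_Mdown MdownE; apply/seteqP; split=> x [h Ax].
  by split=> //; split=> //; exact: sub.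
by case: h.
Qed.

End Overlapping.

(** Along the axis the two balls leave no room: s (x_1 + r) <= 1 and
    t (r - x_1) <= 1 add up to the reverse inequality, so all are equalities. *)
Lemma lens_tangent x : s + t <= 2 * r * s * t -> lens r s t x ->
  2 * r * s * t = s + t /\ x = axis_pt n (s^-1 - r).
Proof.
move=> hr [sa tb]; move: sa tb; rewrite /cball /= !sqdistE opprK => sa tb.
have w0 : 0 <= sqtail x := dotp_ge0 _.
have bound (k q : R) : 0 < k -> k ^+ 2 * (q ^+ 2 + sqtail x) <= 1 -> k * q <= 1.
  move=> k0 h; apply: (le_trans (ler_norm _)).
  rewrite -(@expr_le1 _ 2) // real_normK ?num_real //.
  have := mulr_ge0 (sqr_ge0 k) w0; lra.
have h1 := bound _ _ s0 sa.
have h2 : t * (r - x 0 0) <= 1.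
  by apply: bound => //; rewrite -[(r - _) ^+ 2]sqrrN opprB.
have g1 := ler_wpM2l (ltW t0) h1; have g2 := ler_wpM2l (ltW s0) h2.
have e : 2 * r * s * t = s + t by lra.
have e1 : s * (x 0 0 + r) = 1.
  by apply: le_anti; rewrite h1 /= -(ler_pM2l t0); lra.
split=> //; apply/axis_eq; split.
  have := congr1 (fun z => s^-1 * z) e1.
  by rewrite mulKf ?gt_eqF // mulr1 => <-; rewrite addrK.
apply: le_anti; rewrite w0 andbT.
have : s ^+ 2 * sqtail x <= 0.
  have : (s * (x 0 0 + r)) ^+ 2 = 1 by rewrite e1 expr1n.
  lra.
by rewrite pmulr_rle0 // exprn_gt0.
Qed.
End Translation.

(** * Disjoint unions of two or three sets *)

Lemma is_sqcup2 T (S A B : set T) : S = A `|` B -> A `&` B = set0 ->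
  is_sqcup S [:: A; B].
Proof.
move=> -> AB; split; first by rewrite !big_cons big_nil setU0.
move=> [|[|i]] [|[|j]] _ _ //=; rewrite ?nth_nil ?set0I ?setI0 ?AB ?[B `&` A]setIC ?AB;
  by case.
Qed.

Lemma is_sqcup3 T (S A B C : set T) : S = A `|` B `|` C ->
  A `&` B = set0 -> A `&` C = set0 -> B `&` C = set0 ->
  is_sqcup S [:: A; B; C].
Proof.
move=> -> AB AC BC; split; first by rewrite !big_cons big_nil setU0 setUA.
move=> [|[|[|i]]] [|[|[|j]]] _ _ //=; rewrite ?nth_nil ?set0I ?setI0 ?AB ?AC ?BC
  1?setIC ?AB ?AC ?BC; by case.
Qed.

(** * The five ranges of r *)

Section Cases.
Variables (R : realType) (n : nat) (r sigma1 sigma2 L : R).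
Hypotheses (r0 : 0 < r) (sigma1_0 : 0 < sigma1) (sigma2_0 : 0 < sigma2)
  (L0 : 0 < L).
Local Notation E := 'rV[R]_n.+1.
Local Notation s := (sigma1 / L).
Local Notation t := (sigma2 / L).
Local Notation M := (Mdown r sigma1 sigma2 L : set E).
Local Notation T := (Tset r sigma1 sigma2 L : set E).
Local Notation Tt := (Ttilde r sigma1 sigma2 L : set E).
Local Notation B1 := (B1 r sigma1 L : set E).
Local Notation B2 := (B2 r sigma2 L : set E).
Local Notation H1m := (H1m r sigma1 sigma2 L : set E).
Local Notation H1p := (H1p r sigma1 sigma2 L : set E).
Local Notation H2m := (H2m r sigma1 sigma2 L : set E).
Local Notation H2p := (H2p r sigma1 sigma2 L : set E).

Let s0 : 0 < s. Proof. exact: divr_gt0. Qed.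
Let t0 : 0 < t. Proof. exact: divr_gt0. Qed.

Lemma T_off_foci x : T x -> ~ [set x1s n r; x2s n r] x.
Proof. by case=> n1 n2 _ _ _ [] /=. Qed.

Lemma empty_cap1 : 2 * r * s <= 1 -> boundary B1 `&` ~` H1m = set0.
Proof.
move=> h; apply/seteqP; split=> // x; rewrite B1E // boundary_oball => -[e]; apply.
by apply: cball_before_edge1 => //; rewrite /cball /= e.
Qed.

Lemma empty_cap2 : 2 * r * t <= 1 -> boundary B2 `&` ~` H2p = set0.
Proof.
move=> h; apply/seteqP; split=> // x; rewrite B2E // boundary_oball => -[e]; apply.
by apply: cball_before_edge2 => //; rewrite /cball /= e.
Qed.

Lemma small_r_overlap : 2 * r * t <= 1 -> 2 * r * s * t < s + t.
Proof.
move=> h; have -> : 2 * r * s * t = s * (2 * r * t) by ring.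
by apply: (@le_lt_trans _ _ s); [rewrite ler_piMr // ltW | rewrite ltrDl].
Qed.

Lemma beyond_edge1_interior x : 2 * r * s * t < s + t ->
  B1 x -> ~ H1m x -> (region r s t `&` (oball s (- r) `&` oball t r)) x.
Proof.
move=> hr; rewrite B1E // => sa /negP; rewrite -ltNge => hx.
have [rx tb] := beyond_edge1 r0 sigma1_0 sigma2_0 L0 hr (ltW sa) (ltW hx) (or_introl sa).
by split.
Qed.

Lemma beyond_edge2_interior x : 2 * r * s * t < s + t ->
  B2 x -> ~ H2p x -> (region r s t `&` (oball s (- r) `&` oball t r)) x.
Proof.
move=> hr; rewrite B2E // => tb /negP; rewrite -ltNge => hx.
have [rx sa] := beyond_edge2 r0 sigma1_0 sigma2_0 L0 hr (ltW tb) (ltW hx) (or_introl tb).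
by split.
Qed.

Lemma cap1_Tset_disjoint : boundary B1 `&` ~` H1m `&` T = set0.
Proof.
apply/seteqP; split=> // x; rewrite B1E // boundary_oball TsetE //.
case=> -[e]; move=> /negP; rewrite -ltNge => hx [[_ hg] _].
have := sphere_gap0_edge s0 e hg => h0.
by have := edge1_lt0 r0 sigma1_0 sigma2_0 L0 x; rewrite hx h0 ltxx.
Qed.

Lemma cap2_Tset_disjoint : boundary B2 `&` ~` H2p `&` T = set0.
Proof.
apply/seteqP; split=> // x; rewrite B2E // boundary_oball TsetE //.
case=> -[e]; move=> /negP; rewrite -ltNge => hx [[_ hg] _].
have hg' : gap t s r (sqdist r x) (sqdist (- r) x) = 0 by rewrite gapC.
have h0 := sphere_gap0_edge t0 e hg'.
by have := edge2_lt0 r0 sigma1_0 sigma2_0 L0 x; rewrite hx h0 ltxx.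
Qed.

(** The condition 2 r s <= 1 says that x2* lies in the first closed ball, and
    2 r t <= 1 that x1* lies in the second one. *)
Lemma both_foci_case : 2 * r * s <= 1 -> 2 * r * t <= 1 ->
  [/\ open M, is_sqcup (boundary M) [:: T; [set x1s n r; x2s n r]] & M° = Tt].
Proof.
move=> hs ht; have hr := small_r_overlap ht.
have intE : M° = M.
  rewrite interior_Mdown // MdownE //; apply/seteqP; split=> x; first by case.
  move=> rx; have [[sa tb] _] := rx; split=> //; split.
    by apply: region_before_edge1 rx _ => //; apply: cball_before_edge1.
  by apply: region_before_edge2 rx _ => //; apply: cball_before_edge2.
split; first exact/interior_id; last by rewrite intE MdownE // TtildeE.
apply: is_sqcup2; last first.
  by apply/seteqP; split=> // x [/T_off_foci].
rewrite boundary_Mdown // empty_cap1 // empty_cap2 // !set0U; congr (_ `|` _).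
by apply: setIidl => x [->|->]; [apply/lens_focus1 | apply/lens_focus2].
Qed.

Lemma one_focus_case : 1 < 2 * r * s -> 2 * r * t <= 1 ->
  [/\ closed ((M `|` C1 r sigma1 sigma2 L) `&` H1p), open (M `&` ~` H1p),
      is_sqcup (boundary M) [:: boundary B1 `&` ~` H1m; T; [set x1s n r]]
    & is_sqcup M° [:: B1 `&` ~` H1m; Tt `&` H1m]].
Proof.
move=> hs ht; have hr := small_r_overlap ht.
have inB2 x : region r s t x -> oball t r x.
  move=> rx; apply: region_before_edge2 (rx) _ => //.
  by apply: cball_before_edge2 => //; case: rx => -[].
split.
- exact: closed_Mdown_C1.
- apply: open_Mdown_inter => //.
    by apply/closed_openC/closed_ge_fun/coord0_continuous.
  move=> x [rx /negP hx]; split; last exact: inB2.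
  by apply: region_before_edge1 rx _ => //; rewrite leNgt; apply: contra hx => /ltW.
- have fE : [set x1s n r; x2s n r] `&` lens r s t = [set x1s n r].
    apply/seteqP; split=> x /=; [case=> -[->|->] //|move=> ->].
      by move/lens_focus2 => /(_ r0 sigma1_0 L0); rewrite leNgt hs.
    by split; [left | apply/lens_focus1].
  apply: is_sqcup3.
  + by rewrite boundary_Mdown // (empty_cap2 ht) setU0 fE setUA.
  + exact: cap1_Tset_disjoint.
  + apply/seteqP; split=> // x [[bx _] /= xf]; move: bx.
    rewrite xf B1E // boundary_oball /= sqdist_axis subrr expr0n mulr0 => /eqP.
    by rewrite eq_sym oner_eq0.
  + by apply/seteqP; split=> // x [/T_off_foci h /= xf]; apply: h; left.
- apply: is_sqcup2.
    rewrite interior_Mdown // TtildeE //; apply/seteqP; split=> x.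
      move=> [rx [sa tb]]; have [hx|hx] := pselect (H1m x); first by right.
      by left; rewrite B1E.
    case=> [[hB hx]|[rx hx]]; first exact: beyond_edge1_interior.
    split=> //; split; [exact: region_before_edge1 rx hx | exact: inB2].
  by apply/seteqP; split=> // x [[_ h] [_ /h]].
Qed.

Lemma no_focus_case : 1 < 2 * r * s -> 1 < 2 * r * t -> 2 * r * s * t < s + t ->
  [/\ closed ((M `|` C1 r sigma1 sigma2 L) `&` H1p),
      closed ((M `|` C2 r sigma1 sigma2 L) `&` H2m),
      open (M `&` ~` (H1p `|` H2m)),
      is_sqcup (boundary M)
        [:: boundary B1 `&` ~` H1m; boundary B2 `&` ~` H2p; T]
    & is_sqcup M°
        [:: B1 `&` ~` H1m; B2 `&` ~` H2p; Tt `&` (H1m `&` H2p)]].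
Proof.
move=> hs ht hr.
have sep x : ~ H1m x -> ~ H2p x -> False.
  move=> /negP; rewrite -ltNge => h1 /negP; rewrite -ltNge => h2.
  have := lt_trans (lt_trans h1 h2) (lambda2_lt_lambda1 n r0 sigma1_0 sigma2_0 L0 hr).
  by rewrite ltxx.
split.
- exact: closed_Mdown_C1.
- exact: closed_Mdown_C2.
- apply: open_Mdown_inter => //.
    apply/closed_openC/closedU; first exact/closed_ge_fun/coord0_continuous.
    exact/closed_le_fun/coord0_continuous.
  move=> x [rx /not_orP[/negP h1 /negP h2]].
  split; [apply: region_before_edge1 rx _ | apply: region_before_edge2 rx _] => //.
    by rewrite leNgt; apply: contra h1 => /ltW.
  by rewrite leNgt; apply: contra h2 => /ltW.
- have fE : [set x1s n r; x2s n r] `&` lens r s t = set0.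
    apply/seteqP; split=> // x /=; case=> -[->|->].
      by move/lens_focus1 => /(_ r0 sigma2_0 L0); rewrite leNgt ht.
    by move/lens_focus2 => /(_ r0 sigma1_0 L0); rewrite leNgt hs.
  apply: is_sqcup3.
  + by rewrite boundary_Mdown // fE setU0.
  + by apply/seteqP; split=> // x [[_ h1] [_ h2]]; exact: (sep x).
  + exact: cap1_Tset_disjoint.
  + exact: cap2_Tset_disjoint.
- apply: is_sqcup3.
  + rewrite interior_Mdown // TtildeE //; apply/seteqP; split=> x.
      move=> [rx [sa tb]]; have [h1|h1] := pselect (H1m x); last first.
        by left; left; rewrite B1E.
      have [h2|h2] := pselect (H2p x); first by right.
      by left; right; rewrite B2E.
    case=> [[[hB hx]|[hB hx]]|[rx [h1 h2]]].
    * exact: beyond_edge1_interior.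
    * exact: beyond_edge2_interior.
    * split=> //; split; [exact: region_before_edge1 rx h1 | exact: region_before_edge2 rx h2].
  + by apply/seteqP; split=> // x [[_ h1] [_ h2]]; exact: (sep x).
  + by apply/seteqP; split=> // x [[_ h1] [_ [/h1]]].
  + by apply/seteqP; split=> // x [[_ h1] [_ [_ /h1]]].
Qed.

Lemma tangent_case : 2 * r * s * t = s + t ->
  M = [set axis_pt n (s^-1 - r)].
Proof.
move=> h; have sE : r + r = s^-1 + t^-1.
  have st0 : s * t != 0 by rewrite mulf_neq0 ?gt_eqF.
  apply: (mulfI st0); have -> : s * t * (r + r) = s + t by rewrite -h; ring.
  by field; rewrite !gt_eqF.
apply/seteqP; split=> x.
  have inlens : lens r s t x -> x = axis_pt n (s^-1 - r).
    by move=> /lens_tangent[] //; rewrite h.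
  case; first by rewrite TtildeE // => -[/inlens].
  case=> _ e1 e2; apply: inlens; split; rewrite /cball /=.
    by rewrite (enorm_eq L0 sigma1_0 e1).
  by rewrite (enorm_eq L0 sigma2_0 e2).
move=> ->; right; split.
- rewrite foci_diff enorm_axis gtr0_norm ?mulr_gt0 // mulr_natl mulr2n sE.
  by field; rewrite !gt_eqF.
- rewrite /enorm -/(sqdist (- r) _) sqdist_axis sqrtr_sqr opprK subrK.
  by rewrite gtr0_norm ?invr_gt0 // invf_div.
- rewrite /enorm -/(sqdist r _) sqdist_axis sqrtr_sqr.
  have -> : s^-1 - r - r = - t^-1 by rewrite -addrA -opprD sE; ring.
  by rewrite normrN gtr0_norm ?invr_gt0 // invf_div.
Qed.

Lemma apart_case : s + t < 2 * r * s * t -> M = set0.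
Proof.
move=> h; apply/seteqP; split=> // x.
have nolens : ~ lens r s t x.
  move=> /lens_tangent[] //; first exact: ltW.
  by move=> e; move: h; rewrite e ltxx.
case; first by rewrite TtildeE // => -[].
case=> _ e1 e2; apply: nolens; split; rewrite /cball /=.
  by rewrite (enorm_eq L0 sigma1_0 e1).
by rewrite (enorm_eq L0 sigma2_0 e2).
Qed.
End Cases.

Unset Implicit Arguments.

Theorem theorem5p4 (R : realType) (n : nat) (r sigma1 sigma2 L : R)
    (r_gt0 : 0 < r) (sigma1_gt0 : 0 < sigma1) (sigma2_gt0 : 0 < sigma2)
    (L_gt0 : 0 < L) (sigma12 : sigma1 >= sigma2) :
  let x1 : 'rV[R]_n.+1 := x1s n r in
  let x2 : 'rV[R]_n.+1 := x2s n r in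
  let B1 : set 'rV[R]_n.+1 := B1 r sigma1 L in
  let B2 : set 'rV[R]_n.+1 := B2 r sigma2 L in
  let M : set 'rV[R]_n.+1 := Mdown r sigma1 sigma2 L in
  let T : set 'rV[R]_n.+1 := Tset r sigma1 sigma2 L in
  let Tt : set 'rV[R]_n.+1 := Ttilde r sigma1 sigma2 L in
  let H1p : set 'rV[R]_n.+1 := H1p r sigma1 sigma2 L in
  let H1m : set 'rV[R]_n.+1 := H1m r sigma1 sigma2 L in
  let H2p : set 'rV[R]_n.+1 := H2p r sigma1 sigma2 L in
  let H2m : set 'rV[R]_n.+1 := H2m r sigma1 sigma2 L in
  let C1 : set 'rV[R]_n.+1 := C1 r sigma1 sigma2 L in
  let C2 : set 'rV[R]_n.+1 := C2 r sigma1 sigma2 L in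
  [/\ r \in `]0, L / (2 * sigma1)] ->
        [/\ open M,
            is_sqcup (boundary M) [:: T; [set x1; x2]]
          & M° = Tt],
      r \in `]L / (2 * sigma1), L / (2 * sigma2)] ->
        [/\ closed ((M `|` C1) `&` H1p),
            open (M `&` ~` H1p),
            is_sqcup (boundary M)
              [:: boundary B1 `&` ~` H1m; T; [set x1]]
          & is_sqcup M° [:: B1 `&` ~` H1m; Tt `&` H1m]],
      r \in `]L / (2 * sigma2), L / 2 * (1 / sigma1 + 1 / sigma2)[ ->
        [/\ closed ((M `|` C1) `&` H1p),
            closed ((M `|` C2) `&` H2m),
            open (M `&` ~` (H1p `|` H2m)),
            is_sqcup (boundary M)
              [:: boundary B1 `&` ~` H1m; boundary B2 `&` ~` H2p; T]
          & is_sqcup M°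
              [:: B1 `&` ~` H1m; B2 `&` ~` H2p; Tt `&` (H1m `&` H2p)]],
      r = L / 2 * (1 / sigma1 + 1 / sigma2) ->
        M = [set axis_pt n (L / 2 * (1 / sigma1 - 1 / sigma2))]
    & r \in `]L / 2 * (1 / sigma1 + 1 / sigma2), +oo[ ->
        M = set0].
Proof.
move=> x1 x2 B1' B2' M T Tt H1p' H1m' H2p' H2m' C1' C2'.
have s0 : 0 < sigma1 / L by exact: divr_gt0.
have t0 : 0 < sigma2 / L by exact: divr_gt0.
have ts : sigma2 / L <= sigma1 / L by rewrite ler_pM2r // invr_gt0.
(* Multiplied by 2 k / L, the bounds on r become conditions on 2 r s, 2 r t. *)
have half (k : R) : 0 < k -> r * (2 * (k / L)) = 2 * r * (k / L) /\
    L / (2 * k) * (2 * (k / L)) = 1 /\ 0 < 2 * (k / L).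
  move=> k0; split; first by ring.
  by split; [field; rewrite !gt_eqF | rewrite mulr_gt0 // divr_gt0].
have le_half (k : R) : 0 < k -> (r <= L / (2 * k)) = (2 * r * (k / L) <= 1).
  by move=> /half[e1 [e2 p]]; rewrite -[LHS](ler_pM2r p) e1 e2.
have lt_half (k : R) : 0 < k -> (L / (2 * k) < r) = (1 < 2 * r * (k / L)).
  by move=> /half[e1 [e2 p]]; rewrite -[LHS](ltr_pM2r p) e1 e2.
have st0 : 0 < 2 * (sigma1 / L) * (sigma2 / L) by rewrite !mulr_gt0 ?invr_gt0.
have sumE : L / 2 * (1 / sigma1 + 1 / sigma2) * (2 * (sigma1 / L) * (sigma2 / L))
    = sigma1 / L + sigma2 / L by field; rewrite !gt_eqF.
have prodE : r * (2 * (sigma1 / L) * (sigma2 / L))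
    = 2 * r * (sigma1 / L) * (sigma2 / L) by ring.
split; rewrite ?in_itv /=.
- move=> /andP[_]; rewrite le_half // => hs; apply: both_foci_case => //.
  by apply: le_trans hs; rewrite ler_wpM2l // mulr_ge0 // ltW.
- move=> /andP[]; rewrite lt_half // le_half // => hs ht.
  exact: one_focus_case.
- move=> /andP[]; rewrite lt_half // => ht hr.
  apply: no_focus_case => //.
    by apply: (lt_le_trans ht); rewrite ler_wpM2l // mulr_ge0 // ltW.
  by rewrite -prodE -sumE ltr_pM2r.
- move=> hr; rewrite /M tangent_case //; last by rewrite -prodE -sumE -hr.
  by congr [set axis_pt n _]; rewrite hr; field; rewrite !gt_eqF.
- rewrite andbT => hr; apply: apart_case => //.
  by rewrite -prodE -sumE ltr_pM2r.
Qed.
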